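(* For every $\lambda\in(0,1)$ and every $k>0$, the family $\{\pi_n^k\}_{n\ge k}$ of probability measures on the countable set $\Gamma_k$ is tight: for every $\delta>0$ there is a finite set $K\subseteq\Gamma_k$ (equivalently, an $L$ such that all edges of the configuration lie in $[-L/2,L/2]^2$) with $\pi_n^k(K)\ge1-\delta$ for all $n\ge k$.
   Context: For an integer $n$, let $\Lambda^0_n$ be the set of integer points in $[-n/2,n/2]^2$ and $\Lambda_n$ the set of midpoints of edges of triangulations of $\Lambda^0_n$ (a triangulation being a maximal set of pairwise disjoint open straight segments with endpoints in $\Lambda_n^0$ containing no point of $\Lambda_n^0$; all triangulations have the same midpoint set, and $\sigma_x$ denotes the edge of $\sigma$ with midpoint $x$). Let $\Omega_n$ be the set of all triangulations of $\Lambda_n^0$ (free boundary condition) and, for $\lambda>0$, $\pi_n(\sigma)\propto\lambda^{\sum_{x\in\Lambda_n}|\sigma_x|}$, with $|\cdot|$ the $\ell_1$ length. For $k>0$ let $\Upsilon_k=[-k/2,k/2]^2\cap\Lambda_n$, $\sigma_{\Upsilon_k}$ the set of edges of $\sigma$ with midpoints in $\Upsilon_k$, $\Gamma_k=\bigcup_{n\ge k}\{\sigma_{\Upsilon_k}:\sigma\in\Omega_n\}$, and $\pi^k_n$ the law of $\sigma_{\Upsilon_k}$ when $\sigma\sim\pi_n$, viewed as a probability measure on $\Gamma_k$. *)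

(* Defs.v *)
From HB Require Import structures.
From mathcomp Require Import all_boot all_order all_algebra.
From Stdlib Require Import ClassicalDescription.
Set Implicit Arguments. Unset Strict Implicit. Unset Printing Implicit Defensive.
Import Order.TTheory GRing.Theory Num.Theory.
Local Open Scope ring_scope.

Definition asb (P : Prop) : bool :=
  if excluded_middle_informative P then true else false.

(* Integer points of [-n/2,n/2]^2 are the (a,b) with |a|,|b| <= floor(n/2);
   we index them by 'I_side x 'I_side, coordinate i |-> i - floor(n/2). *)
Definition side (n : nat) : nat := (n./2).*2.+1.
Definition pt (n : nat) : finType := ('I_(side n) * 'I_(side n))%type.
Definition crd (n : nat) (i : 'I_(side n)) : int := (i : nat)%:Z - (n./2)%:Z.

(* A segment is a pair (p,q) of lattice points, stored with p strictly before
   q lexicographically, so that each unordered segment {p,q} has exactly one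
   representative. *)
Definition seg (n : nat) : finType := (pt n * pt n)%type.
Definition canon (n : nat) (e : seg n) : bool :=
  ((e.1.1 < e.2.1)%N || ((e.1.1 == e.2.1) && (e.1.2 < e.2.2)%N)).

Definition ptR (R : numDomainType) (n : nat) (p : pt n) : R * R :=
  ((crd p.1)%:~R, (crd p.2)%:~R).

Definition in_openseg (R : numDomainType) (n : nat) (e : seg n) (x : R * R) : Prop :=
  exists t : R, 0 < t < 1 /\
    x = ((ptR R e.1).1 + t * ((ptR R e.2).1 - (ptR R e.1).1),
         (ptR R e.1).2 + t * ((ptR R e.2).2 - (ptR R e.1).2)).

Definition admissible (R : numDomainType) (n : nat) (e : seg n) : Prop :=
  canon e /\ forall r : pt n, ~ in_openseg e (ptR R r).

Definition good_family (R : numDomainType) (n : nat) (s : {set seg n}) : Prop :=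
  (forall e, e \in s -> admissible R e) /\
  (forall e f, e \in s -> f \in s -> e <> f ->
     forall x : R * R, ~ (in_openseg e x /\ in_openseg f x)).

Definition triangulation (R : numDomainType) (n : nat) (s : {set seg n}) : Prop :=
  good_family R s /\
  (forall s' : {set seg n}, good_family R s' -> s \subset s' -> s' = s).

Definition Omega (R : numDomainType) (n : nat) : {set {set seg n}} :=
  [set s | asb (triangulation R s)].

Definition elen (n : nat) (e : seg n) : nat :=
  `|crd e.1.1 - crd e.2.1|%N + `|crd e.1.2 - crd e.2.2|%N.
Definition tlen (n : nat) (s : {set seg n}) : nat := (\sum_(e in s) elen e)%N.

(* midpoint of e lies in [-k/2,k/2]^2 *)
Definition mid_in_box (k n : nat) (e : seg n) : bool :=
  (`|crd e.1.1 + crd e.2.1| <= k%:Z) && (`|crd e.1.2 + crd e.2.2| <= k%:Z).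

Definition pt_in_box (L n : nat) (p : pt n) : bool :=
  (`|2 * crd p.1| <= L%:Z) && (`|2 * crd p.2| <= L%:Z).

Definition confined (k L n : nat) (s : {set seg n}) : bool :=
  [forall e in s, mid_in_box k e ==> (pt_in_box L e.1 && pt_in_box L e.2)].

Definition weight (R : numDomainType) (lam : R) (n : nat) (s : {set seg n}) : R :=
  lam ^+ tlen s.
Definition prob (R : numFieldType) (lam : R) (n : nat) (A : pred {set seg n}) : R :=
  (\sum_(s in Omega R n | A s) weight lam s) / (\sum_(s in Omega R n) weight lam s).

(* Main.v *)
Require Import Defs.
From HB Require Import structures.
From mathcomp Require Import all_boot all_order all_algebra.
From mathcomp Require Import zify ring lra.
Import Order.TTheory GRing.Theory Num.Theory.
Local Open Scope ring_scope.
Set Implicit Arguments. Unset Strict Implicit. Unset Printing Implicit Defensive.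

(** An edge which is the longest side of both adjacent triangles is the long
    diagonal of a unimodular parallelogram with sides u, v (|u| > |v|); flipping it
    shortens the triangulation by 2|v|, hence gains a factor lam^(-2|v|).  For any
    nonnegative function on parallelograms, bijectivity of the flip equates its
    expectation over long diagonals with that of its product with lam^(2|v|) over
    short diagonals.  Taking the function g^(3 |long diagonal|), damped by a factor
    g^(-1) per unit of distance from the origin, a discharging argument along the
    triangles (each sends a charge from its longest side to the two shorter ones)
    shows that the short diagonals cost at most a fraction < 1 of the long ones, up
    to an error proportional to the damped number of edges.  Hence the expectation
    over long diagonals is bounded uniformly in n.  Since every edge of length at
    least 2 lies below such a doubly longest edge, at distance at most the increase
    in length, a long edge near the origin forces an exponentially large value, and
    Markov's inequality concludes. *)

(** * Lattice triangles of determinant one *)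

(** The exponent 3 splits as 1 + 2. One power of [g] per unit of length pays for the damping: from a
    side of a triangle to its longest side, twice the midpoint moves by exactly the gain in length.
    The other two powers feed the discharging, and [g > 1] only has to satisfy lam^2 g^4 < 1, which
    is where lam < 1 enters. Damping makes the error uniform in n: distinct edges have distinct
    midpoints, so the damped number of edges is a planar geometric sum. The geometric obstacle is
    that a triangulation is given only as a maximal family of disjoint segments, with no triangles
    in sight. The triangles next to an edge, and the fact that a flip preserves maximality, must be
    extracted from maximality alone. Both are reduced to sign conditions on integer determinants, in
    coordinates where the edge or the parallelogram is standard. *)

Definition btw (a b c : int) := (a <= b <= c) || (c <= b <= a).

(** If no vertex is middle in both coordinates, then, seen from one that is middle in the second,
    the two products in the determinant never have the same sign, and their absolute values add up
    to at least 2. This gives every unimodular triangle its longest side. *)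
Lemma unimodular_middle (a1 a2 b1 b2 c1 c2 : int) :
  `|(b1 - a1) * (c2 - a2) - (b2 - a2) * (c1 - a1)| = 1 ->
  [|| btw a1 b1 c1 && btw a2 b2 c2, btw b1 c1 a1 && btw b2 c2 a2 | btw c1 a1 b1 && btw c2 a2 b2].
Proof.
have -> : b1 = a1 + (b1 - a1) by ring.
have -> : c1 = a1 + (c1 - a1) by ring.
have -> : b2 = a2 + (b2 - a2) by ring.
have -> : c2 = a2 + (c2 - a2) by ring.
move: (b1 - a1) (c1 - a1) (b2 - a2) (c2 - a2) => x y z t; rewrite /btw.
nia.
Qed.

(** A Euclidean step: two vectors of one quadrant that are not comparable coordinatewise have
    determinant beyond 1, except for the two unit vectors, whose lengths are equal. *)
Lemma farey_reduce (u1 u2 v1 v2 : int) : `|u1 * v2 - u2 * v1| = 1 ->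
  btw 0 u1 (u1 + v1) -> btw 0 u2 (u2 + v2) -> `|v1| + `|v2| < `|u1| + `|u2| ->
  btw 0 v1 u1 && btw 0 v2 u2.
Proof. by rewrite /btw; nia. Qed.

(* The segment from [a] (below the diagonal) to [b] (above it) crosses the diagonal
   of the unit square; [D] and its shifts are the values of its linear form at the
   four vertices, so the hypotheses say that it crosses neither of the two sides
   through (1,0) and does not pass through (1,0). *)
Lemma unit_square_exit (ax ay bx by_ : int) : let D := ax * by_ - ay * bx in
  ay < ax -> bx < by_ ->
  D * (D + (bx - ax) - (by_ - ay)) < 0 ->
  ~ (D * (D - (by_ - ay)) < 0 /\ ay * by_ < 0) ->
  ~ ((D - (by_ - ay)) * (D + (bx - ax) - (by_ - ay)) < 0 /\ (ax - 1) * (bx - 1) < 0) ->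
  ~ (D - (by_ - ay) = 0 /\ ay * by_ < 0) ->
  ax = 1 /\ ay = 0.
Proof.
move=> D ha hb hpq hpm hmq hm.
have [hD0 hDq] : 0 < D /\ D + (bx - ax) - (by_ - ay) < 0 by nia.
have [hF|hF|hF] := ltgtP (D - (by_ - ay)) 0.
- exfalso; apply: hpm; split; first by nia.
  rewrite /D in hD0 hDq hF.
  have h1 : ay < 0 by nia.
  have h2 : 0 < by_ by nia.
  nia.
- exfalso; apply: hmq; split; first by nia.
  rewrite /D in hD0 hDq hF.
  have h1 : 1 < ax by nia.
  have h2 : bx < 1 by nia.
  nia.
- rewrite /D in hD0 hDq hF.
  have h1 : ~ (ay < 0).
    move=> h1; apply: hm; split; first by rewrite /D.
    have h2 : 0 < by_ by nia. nia.
  have h3 : ay = 0 by nia.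
  split=> //. nia.
Qed.

(** * Visibility across a strip of height one *)

Definition dt (ax ay bx by_ cx cy : int) : int :=
  (bx - ax) * (cy - ay) - (by_ - ay) * (cx - ax).

(* In the coordinates used here the base edge is the segment from (0,0) to (1,0). *)
Lemma strip_cross (ax ay bx by_ cx cy dx dy : int) :
  ay <= 0 -> 0 < by_ -> cy <= 0 -> 0 < dy -> by_ <= dy ->
  ax * by_ - ay * bx <= 0 -> dy - cy <= cx * dy - cy * dx ->
  dt cx cy dx dy bx by_ < 0 ->
  0 < dt cx cy dx dy ax ay /\ dt ax ay bx by_ cx cy < 0 < dt ax ay bx by_ dx dy.
Proof.
move=> ay0 by0 cy0 dy0 hbd hf hg.
have e1 : dt cx cy dx dy ax ay * by_ + dt cx cy dx dy bx by_ * (- ay) =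
    (cx * dy - cy * dx) * (by_ - ay) - (ax * by_ - ay * bx) * (dy - cy).
  rewrite /dt; ring.
have e2 : dt ax ay bx by_ cx cy * (dy - by_) + dt ax ay bx by_ dx dy * (by_ - cy) =
    - (by_ - ay) * dt cx cy dx dy bx by_.
  rewrite /dt; ring.
have e3 : dt ax ay bx by_ cx cy * dy - dt ax ay bx by_ dx dy * cy =
    (ax * by_ - ay * bx) * (dy - cy) - (cx * dy - cy * dx) * (by_ - ay).
  rewrite /dt; ring.
have p1 : 0 < (cx * dy - cy * dx) * (by_ - ay) - (ax * by_ - ay * bx) * (dy - cy).
  by move: hf hg; set u := (ax * _ - _); set v := (cx * _ - _) => hf hg; nia.
move: (dt cx cy dx dy ax ay) (dt cx cy dx dy bx by_) (dt ax ay bx by_ cx cy) (dt ax ay bx by_ dx dy) e1 e2 e3 => G Gb A B e1 e2 e3 hx.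
have hB : 0 < B by nia.
split; first by nia.
by rewrite hB andbT; nia.
Qed.

Lemma exists_arg_max_ratio (I : finType) (P : pred I) (N H : I -> int) :
  (forall f, P f -> 0 < H f) ->
  (exists f, P f) ->
  exists2 f0, P f0 & forall f, P f -> N f * H f0 <= N f0 * H f.
Proof.
move=> Hpos [f1 Pf1].
pose key f : rat := (N f)%:~R / (H f)%:~R.
have [f0 Pf0 hmax] := arg_maxP key Pf1.
exists f0 => // f Pf; have : key f <= key f0 := hmax f Pf; rewrite /key.
rewrite ler_pdivrMr ?ltr0z ?Hpos // mulrAC ler_pdivlMr ?ltr0z ?Hpos //.
by rewrite -!intrM ler_int.
Qed.

Section Strip.

Variables (I : finType) (F : pred I).

(* For a segment from height [ay <= 0] to height [by_ > 0], the abscissas at heights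
   0 and 1 are [strip_N0 / (by_ - ay)] and [strip_N1 / (by_ - ay)]. *)
Definition strip_N0 (ax ay bx by_ : int) : int := ax * by_ - ay * bx.
Definition strip_N1 (ax ay bx by_ : int) : int := ax * by_ - ay * bx + (bx - ax).

(** Models the edges that rise from height at most 0 to height at least 1: at height 0 they miss the
    open base, passing on its left or on its right, and no two of them cross. *)
Definition strip_family (ax ay bx by_ : I -> int) : Prop :=
  (forall f, F f -> [/\ ay f <= 0, 0 < by_ f &
     strip_N0 (ax f) (ay f) (bx f) (by_ f) <= 0 \/
     by_ f - ay f <= strip_N0 (ax f) (ay f) (bx f) (by_ f)]) /\
  (forall f g, F f -> F g ->
     ~ (dt (ax g) (ay g) (bx g) (by_ g) (ax f) (ay f) *
        dt (ax g) (ay g) (bx g) (by_ g) (bx f) (by_ f) < 0 /\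
        dt (ax f) (ay f) (bx f) (by_ f) (ax g) (ay g) *
        dt (ax f) (ay f) (bx f) (by_ f) (bx g) (by_ g) < 0)).

(** The point (j, 1) lies between the segments passing left of the base and those passing right, so
    it can be joined to both ends of the base. *)
Definition strip_sep (ax ay bx by_ : I -> int) (j : int) : Prop :=
  forall f, F f ->
    (strip_N0 (ax f) (ay f) (bx f) (by_ f) <= 0 ->
     strip_N1 (ax f) (ay f) (bx f) (by_ f) <= j * (by_ f - ay f)) /\
    (by_ f - ay f <= strip_N0 (ax f) (ay f) (bx f) (by_ f) ->
     j * (by_ f - ay f) <= strip_N1 (ax f) (ay f) (bx f) (by_ f)).

Lemma strip_family_mirror (ax ay bx by_ : I -> int) :
  strip_family ax ay bx by_ ->
  strip_family (fun f => 1 - ax f) ay (fun f => 1 - bx f) by_.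
Proof.
move=> [h1 h2]; split=> [f /h1 [ha hb hc]|f g Ff Fg].
  split=> //; move: hc; rewrite /strip_N0.
  have -> : (1 - ax f) * by_ f - ay f * (1 - bx f) = by_ f - ay f - (ax f * by_ f - ay f * bx f) by ring.
  by lia.
have := h2 f g Ff Fg.
have dm (a b c d e h : int) : dt (1 - a) b (1 - c) d (1 - e) h = - dt a b c d e h.
  by rewrite /dt; ring.
by rewrite !dm !mulrNN.
Qed.

Lemma strip_sep_mirror (ax ay bx by_ : I -> int) j :
  strip_sep (fun f => 1 - ax f) ay (fun f => 1 - bx f) by_ j ->
  strip_sep ax ay bx by_ (1 - j).
Proof.
move=> h f /h; rewrite /strip_N0 /strip_N1.
have -> : (1 - ax f) * by_ f - ay f * (1 - bx f) = by_ f - ay f - (ax f * by_ f - ay f * bx f) by ring.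
by lia.
Qed.

Lemma ceil_multiple (x y : int) : 0 < y -> exists j, x <= j * y <= x + y - 1.
Proof.
move=> hy; exists ((x + y - 1) %/ y)%Z.
have e := divz_eq (x + y - 1) y.
have h1 := modz_ge0 (x + y - 1) (lt0r_neq0 hy).
have h2 := ltz_pmod (x + y - 1) hy.
by lia.
Qed.

(* Among the segments passing on the left, one meeting height 1 furthest to the
   right has an upper endpoint that sees the base, and the triangle it spans with
   the base contains the wanted lattice point at height 1. *)
Lemma strip_sep_left (ax ay bx by_ : I -> int) (f0 : I) :
  strip_family ax ay bx by_ -> F f0 ->
  strip_N0 (ax f0) (ay f0) (bx f0) (by_ f0) <= 0 ->
  (forall f, F f -> strip_N0 (ax f) (ay f) (bx f) (by_ f) <= 0 ->
    strip_N1 (ax f) (ay f) (bx f) (by_ f) * (by_ f0 - ay f0) <=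
    strip_N1 (ax f0) (ay f0) (bx f0) (by_ f0) * (by_ f - ay f)) ->
  (forall g, F g -> by_ g - ay g <= strip_N0 (ax g) (ay g) (bx g) (by_ g) ->
    exists g', [/\ F g', by_ g' - ay g' <= strip_N0 (ax g') (ay g') (bx g') (by_ g'),
      strip_N1 (ax g') (ay g') (bx g') (by_ g') * (by_ g - ay g) <=
      strip_N1 (ax g) (ay g) (bx g) (by_ g) * (by_ g' - ay g') & by_ f0 <= by_ g']) ->
  exists2 j, strip_sep ax ay bx by_ j & bx f0 <= j * by_ f0 <= bx f0 + by_ f0 - 1.
Proof.
move=> [fam1 fam2] Ff0 L0 Lmax Rmin.
have [ay0 by0 _] := fam1 _ Ff0.
(* At height 1 the segments from (0,0) and (1,0) to the upper endpoint of [f0] have abscissas bx/by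
   and (bx+by-1)/by; an integer always lies between them. *)
have [j hj] := ceil_multiple (bx f0) by0.
exists j => // f Ff; have [ayf byf _] := fam1 _ Ff; split=> hN.
  have hf0 : strip_N1 (ax f0) (ay f0) (bx f0) (by_ f0) <= j * (by_ f0 - ay f0).
    by move: L0 hj; rewrite /strip_N0 /strip_N1; clear -ay0 by0; nia.
  have := Lmax f Ff hN; move: (strip_N1 (ax f) _ _ _) (strip_N1 (ax f0) _ _ _) hf0 => u v.
  by clear -ay0 by0 ayf byf; nia.
have [g [Fg hg hgf hh]] := Rmin f Ff hN.
have [ayg byg _] := fam1 _ Fg.
have hd : 0 <= dt (ax g) (ay g) (bx g) (by_ g) (bx f0) (by_ f0).
  rewrite leNgt; apply/negP => hd.
  have [c1 /andP[c2 c3]] := strip_cross ay0 by0 ayg byg hh L0 hg hd.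
  by apply: (fam2 f0 g Ff0 Fg); rewrite pmulr_rlt0 // pmulr_llt0.
have hg1 : j * (by_ g - ay g) <= strip_N1 (ax g) (ay g) (bx g) (by_ g).
  move: hd hg hj; rewrite /dt /strip_N1 /strip_N0; move: (ax g) (bx g) (bx f0) => a b c.
  have -> : (b - a) * (by_ f0 - ay g) - (by_ g - ay g) * (c - a) =
    (a * by_ g - ay g * b) + by_ f0 * (b - a) - c * (by_ g - ay g) by ring.
  by move: (a * _ - _) => u; clear -ayg byg by0; nia.
move: hgf hg1; move: (strip_N1 (ax f) _ _ _) (strip_N1 (ax g) _ _ _) => u v.
by clear -ayg byg ayf byf; nia.
Qed.

(* In the second alternative [(j, 1)] lies in the triangle spanned by the base and
   the upper endpoint of [f], hence in every convex region containing them. *)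
Lemma strip_sep_exists (ax ay bx by_ : I -> int) :
  strip_family ax ay bx by_ ->
  exists2 j, strip_sep ax ay bx by_ j &
    j = 0 \/ exists2 f, F f & bx f <= j * by_ f <= bx f + by_ f - 1.
Proof.
move=> fam; have [fam1 _] := fam.
pose L f := F f && (strip_N0 (ax f) (ay f) (bx f) (by_ f) <= 0).
pose R f := F f && (by_ f - ay f <= strip_N0 (ax f) (ay f) (bx f) (by_ f)).
pose H f := by_ f - ay f.
pose N f := strip_N1 (ax f) (ay f) (bx f) (by_ f).
have Hpos f : F f -> 0 < H f by case/fam1 => ? ? _; rewrite /H; lia.
have exL : (exists f, L f) -> exists2 f0, L f0 & forall f, L f -> N f * H f0 <= N f0 * H f.
  by apply: exists_arg_max_ratio => f /andP[/Hpos].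
have exR : (exists f, R f) -> exists2 f0, R f0 & forall f, R f -> N f0 * H f <= N f * H f0.
  move=> h.
  have [||f0 Rf0 hf0] := @exists_arg_max_ratio I R (fun f => - N f) H => //.
    by move=> f /andP[/Hpos].
  by exists f0 => // f /hf0; rewrite !mulNr lerN2.
have fromL f0 : L f0 -> (forall f, L f -> N f * H f0 <= N f0 * H f) ->
  (forall g, R g -> exists g', [/\ R g', N g' * H g <= N g * H g' & by_ f0 <= by_ g']) ->
  exists2 j, strip_sep ax ay bx by_ j &
    j = 0 \/ exists2 f, F f & bx f <= j * by_ f <= bx f + by_ f - 1.
  move=> /andP[Ff0 L0] mL mR.
  have [|g Fg hg|j hj1 hj2] := @strip_sep_left ax ay bx by_ f0 fam Ff0 L0.
  - by move=> f Ff hf; apply: mL; rewrite /L Ff.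
  - by have [|g' [/andP[Fg' hg'] ? ?]] := mR g; [rewrite /R Fg | exists g'].
  - by exists j => //; right; exists f0.
have N1m f : strip_N1 (1 - ax f) (ay f) (1 - bx f) (by_ f) = H f - N f.
  by rewrite /N /H /strip_N1; ring.
have N0m f : strip_N0 (1 - ax f) (ay f) (1 - bx f) (by_ f) =
    by_ f - ay f - strip_N0 (ax f) (ay f) (bx f) (by_ f).
  by rewrite /strip_N0; ring.
have fromR f0 : R f0 -> (forall f, R f -> N f0 * H f <= N f * H f0) ->
  (forall g, L g -> exists g', [/\ L g', N g * H g' <= N g' * H g & by_ f0 <= by_ g']) ->
  exists2 j, strip_sep ax ay bx by_ j &
    j = 0 \/ exists2 f, F f & bx f <= j * by_ f <= bx f + by_ f - 1.
  move=> /andP[Ff0 L0] mR mL.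
  have [||g Fg hg|j hj1 hj2] := @strip_sep_left (fun f => 1 - ax f) ay (fun f => 1 - bx f) by_ f0
    (strip_family_mirror fam) Ff0.
  - by rewrite N0m; lia.
  - move=> f Ff; rewrite N0m !N1m -/(H f) -/(H f0) => hf.
    have := mR f; rewrite /R Ff /= => /(_ ltac:(rewrite /H in hf *; lia)).
    by move: (H f) (H f0) (N f) (N f0) => *; nia.
  - move: hg; rewrite N0m => hg; have [|g' [/andP[Fg' hg'] h1 h2]] := mL g; first by rewrite /L Fg /=; lia.
    exists g'; rewrite N0m !N1m -/(H g) -/(H g'); split=> //; first by rewrite /H; lia.
    by move: (H g) (H g') (N g) (N g') h1 => *; nia.
  - exists (1 - j); first exact: strip_sep_mirror.
    by right; exists f0 => //; move: hj2 => /=; lia.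
have [hL|hL] := boolP [exists f, L f]; have [hR|hR] := boolP [exists f, R f].
- have [f0 Lf0 mL] := exL (existsP hL); have [g0 Rg0 mR] := exR (existsP hR).
  (* Of the two extremal segments, the one whose upper endpoint is lower is used: its endpoint
     cannot be hidden from the base by the other. *)
  have [hle|/ltW hle] := leP (by_ f0) (by_ g0).
    by apply: (fromL f0) => // g Rg; exists g0; split=> //; apply: mR.
  by apply: (fromR g0) => // g Lg; exists f0; split=> //; apply: mL.
- have [f0 Lf0 mL] := exL (existsP hL).
  by apply: (fromL f0) => // g Rg; case/existsP: hR; exists g.
- have [g0 Rg0 mR] := exR (existsP hR).
  by apply: (fromR g0) => // g Lg; case/existsP: hL; exists g.
- exists 0; last by left.
  move=> f Ff; split=> hf; [case/existsP: hL | case/existsP: hR]; exists f; rewrite /L /R Ff //.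
Qed.

End Strip.

(** * Crossing segments *)

Section PlaneSegments.

Variable K : realFieldType.
Implicit Types p q a b x : K * K.

Definition in_seg p q x : Prop :=
  exists t : K, 0 < t < 1 /\ x = (p.1 + t * (q.1 - p.1), p.2 + t * (q.2 - p.2)).

Definition cross p q x : K := (q.1 - p.1) * (x.2 - p.2) - (q.2 - p.2) * (x.1 - p.1).

Lemma in_seg_sym p q x : in_seg p q x -> in_seg q p x.
Proof.
by case=> t [/andP[t0 t1] ->]; exists (1 - t); split; [lra | congr (_, _); ring].
Qed.

Lemma cross_in_seg p q a b :
  cross p q a * cross p q b < 0 -> cross a b p * cross a b q < 0 ->
  exists x, in_seg p q x /\ in_seg a b x.
Proof.
set A := cross p q a; set B := cross p q b; set C := cross a b p; set D := cross a b q.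
move=> hAB hCD.
have eD : C - D = - (A - B) by rewrite /A /B /C /D /cross; ring.
have C_D : C - D != 0.
  by apply/negP => /eqP/subr0_eq h; move: hCD; rewrite h ltNge -expr2 sqr_ge0.
have inI (u v : K) : u * v < 0 -> 0 < u / (u - v) < 1.
  move=> uv; have [u0|u0] := ltP 0 u.
    have v0 : v < 0 by move: uv; rewrite pmulr_rlt0.
    by rewrite divr_gt0 /= ?ltr_pdivrMr ?mul1r; lra.
  have u1 : u < 0 by rewrite lt_neqAle u0 andbT; apply/eqP => e; move: uv; rewrite e mul0r ltxx.
  have v0 : 0 < v by move: uv; rewrite nmulr_rlt0.
  have -> : u / (u - v) = (- u) / (v - u).
    by rewrite -[v - u]opprB invrN mulrNN.
  by rewrite divr_gt0 /= ?ltr_pdivrMr ?mul1r; lra.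
exists (p.1 + C / (C - D) * (q.1 - p.1), p.2 + C / (C - D) * (q.2 - p.2)); split.
  by exists (C / (C - D)); rewrite inI.
exists (A / (A - B)); rewrite inI //; split=> //.
have eA : A / (A - B) = - A / (C - D) by rewrite eD invrN mulrNN.
rewrite eA; congr (_, _); apply: (mulIf C_D); rewrite !mulrDl -!mulrA.
  rewrite ![_^-1 * (_ * _)]mulrCA mulVf // !mulr1.
  by rewrite /A /C /D /cross; ring.
rewrite ![_^-1 * (_ * _)]mulrCA mulVf // !mulr1.
by rewrite /A /C /D /cross; ring.
Qed.

Lemma affine_zero_sign (A B s : K) : 0 < s < 1 -> A * (1 - s) + B * s = 0 ->
  A * B < 0 \/ (A = 0 /\ B = 0).
Proof.
move=> /andP[s0 s1] e; have eB : B * s = - (A * (1 - s)) by lra.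
have [A0|A0] := eqVneq A 0.
  right; split=> //; move: eB; rewrite A0 mul0r oppr0 => /eqP.
  by rewrite mulf_eq0 (gt_eqF s0) orbF => /eqP.
left; have hA : 0 < A ^+ 2 by rewrite exprn_even_gt0.
have h : A * B * s = - (A ^+ 2 * (1 - s)) by rewrite -mulrA eB; ring.
have : A * B * s < 0 by rewrite h oppr_lt0 mulr_gt0 // subr_gt0.
by rewrite pmulr_llt0.
Qed.

(** On the common line, parametrised so that [p] is 0 and [q] is 1, the parameters [u], [v] of [a],
    [b] are not inside the unit interval, and 0 and 1 are not strictly between [u] and [v]; since
    the intervals overlap, they coincide. *)
Lemma collinear_meet p q a b x :
  ~ in_seg p q a -> ~ in_seg p q b -> ~ in_seg a b p -> ~ in_seg a b q ->
  p != q -> cross p q a = 0 -> cross p q b = 0 ->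
  in_seg p q x -> in_seg a b x -> (a = p /\ b = q) \/ (a = q /\ b = p).
Proof.
move=> ha hb hp hq pq ca cb [t [/andP[t0 t1] ->]] [s [/andP[s0 s1] ex]].
set d1 := q.1 - p.1; set d2 := q.2 - p.2.
have N0 : d1 * d1 + d2 * d2 != 0.
  apply/negP => /eqP h; have [e1 e2] : d1 = 0 /\ d2 = 0 by split; nra.
  by case/eqP: pq; apply: injective_projections; rewrite /d1 /d2 in e1 e2; lra.
have onl c : cross p q c = 0 -> exists u, c = (p.1 + u * d1, p.2 + u * d2).
  rewrite /cross -/d1 -/d2 => h; exists (((c.1 - p.1) * d1 + (c.2 - p.2) * d2) / (d1 * d1 + d2 * d2)).
  apply: injective_projections => /=; apply/eqP; rewrite addrC -subr_eq;
    apply/eqP/(mulIf N0); rewrite mulrAC divfK //; apply: subr0_eq.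
    by rewrite -[RHS](mulr0 (- d2)) -h; ring.
  by rewrite -[RHS](mulr0 d1) -h; ring.
have [u eu] := onl _ ca; have [v ev] := onl _ cb.
have et : t = u + s * (v - u).
  case: ex; rewrite eu ev /= -/d1 -/d2 => e1 e2.
  apply: (mulIf N0).
  have f1 : t * d1 = (u + s * (v - u)) * d1 by lra.
  have f2 : t * d2 = (u + s * (v - u)) * d2 by lra.
  by rewrite ![_ * (d1 * d1 + _)]mulrDr !mulrA f1 f2.
have hu : ~ (0 < u < 1) by move=> h; apply: ha; exists u.
have hv : ~ (0 < v < 1) by move=> h; apply: hb; exists v.
have btwI c w : (u < w < v) || (v < w < u) -> c = (p.1 + w * d1, p.2 + w * d2) -> in_seg a b c.
  move=> h ->; exists ((w - u) / (v - u)).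
  have vu : v - u != 0 by apply/negP => /eqP e; case/orP: h => /andP[]; lra.
  split.
    case/orP: h => /andP[h1 h2].
      by rewrite divr_gt0 /= ?ltr_pdivrMr ?mul1r; lra.
    rewrite -[w - u]opprB -[v - u]opprB invrN mulrNN.
    by rewrite divr_gt0 /= ?ltr_pdivrMr ?mul1r; lra.
  rewrite eu ev /=; congr (_, _); apply: (mulIf vu); rewrite ?mulrDl -!mulrA
    ![_^-1 * (_ * _)]mulrCA mulVf // !mulr1; ring.
have hp0 : ~ ((u < 0 < v) || (v < 0 < u)).
  by move/(btwI p 0) => h; apply: hp; apply: h; rewrite !mul0r !addr0; case: (p).
have hq0 : ~ ((u < 1 < v) || (v < 1 < u)).
  move/(btwI q 1) => h; apply: hq; apply: h; rewrite !mul1r /d1 /d2.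
  by rewrite ![_ + (_ - _)]addrC !subrK; case: (q).
have e0 c w : c = (p.1 + w * d1, p.2 + w * d2) -> w = 0 -> c = p.
  by move=> -> ->; rewrite !mul0r !addr0; case: (p).
have e1 c w : c = (p.1 + w * d1, p.2 + w * d2) -> w = 1 -> c = q.
  by move=> -> ->; rewrite !mul1r /d1 /d2 ![_ + (_ - _)]addrC !subrK; case: (q).
have [hle|hgt] := leP u 0.
  have hv1 : 1 <= v by rewrite leNgt; apply/negP => h; apply: hv; apply/andP; split => //; nra.
  have u0 : u = 0 by apply/eqP; rewrite eq_le hle leNgt; apply/negP => h; apply: hp0; rewrite h /=; apply/orP; left; lra.
  have v1 : v = 1 by apply/eqP; rewrite eq_le hv1 andbT leNgt; apply/negP => h; apply: hq0; rewrite h andbT u0 ltr01.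
  by left; split; [apply: e0 eu u0 | apply: e1 ev v1].
have hu1 : 1 <= u by rewrite leNgt; apply/negP => h; apply: hu; rewrite hgt.
have hv0 : v <= 0 by rewrite leNgt; apply/negP => h; apply: hv; apply/andP; split => //; nra.
have v0 : v = 0 by apply/eqP; rewrite eq_le hv0 leNgt; apply/negP => h; apply: hp0; rewrite h /=; apply/orP; right; lra.
have u1 : u = 1 by apply/eqP; rewrite eq_le hu1 andbT leNgt; apply/negP => h; apply: hq0; rewrite h v0 ltr01 orbT.
by right; split; [apply: e1 eu u1 | apply: e0 ev v0].
Qed.

(** Turns disjointness of open segments over the field into signs of determinants, which are
    integers for lattice segments. *)
Lemma meet_cross p q a b x :
  ~ in_seg p q a -> ~ in_seg p q b -> ~ in_seg a b p -> ~ in_seg a b q ->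
  p != q -> a != b -> in_seg p q x -> in_seg a b x ->
  [\/ cross p q a * cross p q b < 0 /\ cross a b p * cross a b q < 0,
      a = p /\ b = q | a = q /\ b = p].
Proof.
move=> ha hb hp hq pq ab hx hx'.
have sgn p' q' a' b' : in_seg p' q' x -> in_seg a' b' x ->
    exists2 s, 0 < s < 1 & cross p' q' a' * (1 - s) + cross p' q' b' * s = 0.
  move=> [t [_ ->]] [s [hs [e1 e2]]]; exists s => //; rewrite /cross.
  have -> : ((q'.1 - p'.1) * (a'.2 - p'.2) - (q'.2 - p'.2) * (a'.1 - p'.1)) * (1 - s) +
    ((q'.1 - p'.1) * (b'.2 - p'.2) - (q'.2 - p'.2) * (b'.1 - p'.1)) * s =
    (q'.1 - p'.1) * (a'.2 + s * (b'.2 - a'.2) - p'.2) -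
    (q'.2 - p'.2) * (a'.1 + s * (b'.1 - a'.1) - p'.1) by ring.
  by rewrite -e1 -e2; ring.
have [s1 hs1 E1] := sgn _ _ _ _ hx hx'; have [s2 hs2 E2] := sgn _ _ _ _ hx' hx.
have [h1|[h1 h1']] := affine_zero_sign hs1 E1; last first.
  by have [h|h] := collinear_meet ha hb hp hq pq h1 h1' hx hx'; [constructor 2|constructor 3].
have [h2|[h2 h2']] := affine_zero_sign hs2 E2; first by constructor 1.
by have [[-> ->]|[-> ->]] := collinear_meet hp hq ha hb ab h2 h2' hx' hx; [constructor 2|constructor 3].
Qed.

End PlaneSegments.

Section LatticeSegments.

Variable n : nat.
Implicit Types p q r a b m : pt n.

Definition px p : int := crd p.1.
Definition py p : int := crd p.2.
Definition det p q r : int := dt (px p) (py p) (px q) (py q) (px r) (py r).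
Definition crossing p q a b : bool :=
  (det p q a * det p q b < 0) && (det a b p * det a b q < 0).

Lemma det_rot p q r : det q r p = det p q r.
Proof. by rewrite /det /dt; ring. Qed.

Lemma det_swap p q r : det q p r = - det p q r.
Proof. by rewrite /det /dt; ring. Qed.

Lemma crossing_sym p q a b : crossing a b p q = crossing p q a b.
Proof. exact: andbC. Qed.

Lemma crossing_swap p q a b : crossing q p a b = crossing p q a b.
Proof. by rewrite /crossing !(det_swap p q) mulrNN [det a b q * _]mulrC. Qed.

Lemma crossing_swapr p q a b : crossing p q b a = crossing p q a b.
Proof. by rewrite -crossing_sym crossing_swap crossing_sym. Qed.

Lemma crossing_self p q : crossing p q p q = false.
Proof.
by apply/negP => /andP[]; rewrite (_ : det p q p = 0) ?mul0r ?ltxx // /det /dt; ring.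
Qed.

Lemma px_bound p : - (n./2)%:Z <= px p <= (n./2)%:Z.
Proof. by rewrite /px /crd; case: p => [[i hi] j] /=; rewrite /side in hi; lia. Qed.

Lemma py_bound p : - (n./2)%:Z <= py p <= (n./2)%:Z.
Proof. by rewrite /py /crd; case: p => [i [j hj]] /=; rewrite /side in hj; lia. Qed.

Lemma pt_ext p q : px p = px q -> py p = py q -> p = q.
Proof.
case: p q => [[i hi] [j hj]] [[i' hi'] [j' hj']]; rewrite /px /py /crd /= => h1 h2.
by congr (_, _); apply: val_inj => /=; lia.
Qed.

Lemma pt_exists (x y : int) : - (n./2)%:Z <= x <= (n./2)%:Z ->
  - (n./2)%:Z <= y <= (n./2)%:Z -> exists p, px p = x /\ py p = y.
Proof.
move=> hx hy.
have hi : (absz (x + (n./2)%:Z)%R < side n)%N by rewrite /side; lia.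
have hj : (absz (y + (n./2)%:Z)%R < side n)%N by rewrite /side; lia.
by exists (Ordinal hi, Ordinal hj); rewrite /px /py /crd /=; lia.
Qed.

Lemma canon_total p q : p != q -> canon (p, q) || canon (q, p).
Proof.
case: p q => [i j] [i' j']; rewrite /canon /= => h.
have : ~~ ((i == i') && (j == j')) by apply: contra h => /andP[/eqP-> /eqP->].
by rewrite -!val_eqE /=; case: (ltngtP i i') => //= _; case: (ltngtP j j').
Qed.

End LatticeSegments.

Definition edge n (s : {set seg n}) (p q : pt n) := ((p, q) \in s) || ((q, p) \in s).

Lemma edge_sym n (s : {set seg n}) p q : edge s p q = edge s q p.
Proof. exact: orbC. Qed.

Section EdgeGeometry.

Variables (R : realFieldType) (n : nat).
Implicit Types (p q r a b m : pt n) (s t : {set seg n}).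

Local Notation pR := (@ptR R n).

Definition empty_seg p q : Prop := p != q /\ forall r, ~ in_seg (pR p) (pR q) (pR r).

Lemma empty_seg_sym p q : empty_seg p q -> empty_seg q p.
Proof. by case=> h h'; split=> [|r /in_seg_sym]; [rewrite eq_sym | apply: h']. Qed.

Lemma crossE p q r : cross (pR p) (pR q) (pR r) = (det p q r)%:~R.
Proof. by rewrite /cross /det /dt /ptR /px /py /= !(rmorphB, rmorphM). Qed.

Lemma ptR_inj : injective pR.
Proof. by move=> p q [/intr_inj h1 /intr_inj h2]; apply: pt_ext. Qed.

Lemma crossing_meet p q a b : crossing p q a b ->
  exists x, in_seg (pR p) (pR q) x /\ in_seg (pR a) (pR b) x.
Proof.
by case/andP=> h1 h2; apply: cross_in_seg; rewrite !crossE -intrM ltrz0.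
Qed.

Lemma meet_crossing p q a b x : empty_seg p q -> empty_seg a b ->
  in_seg (pR p) (pR q) x -> in_seg (pR a) (pR b) x ->
  [\/ crossing p q a b, a = p /\ b = q | a = q /\ b = p].
Proof.
move=> [pq epq] [ab eab] h h'.
have inj u v : u != v -> pR u != pR v by apply: contra => /eqP/ptR_inj->.
have [[h1 h2]|[/ptR_inj-> /ptR_inj->]|[/ptR_inj-> /ptR_inj->]] :=
  meet_cross (epq a) (epq b) (eab p) (eab q) (inj _ _ pq) (inj _ _ ab) h h'.
- by constructor 1; rewrite /crossing -!(ltrz0 R) !intrM -!crossE h1.
- by constructor 2.
- by constructor 3.
Qed.

(** A lattice point z inside [pq] would make the integer [det p z r] a proper fraction of a unit. *)
Lemma unimodular_empty p q r : `|det p q r| = 1 -> empty_seg p q.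
Proof.
move=> h; split.
  apply/negP => /eqP e; move: h; rewrite e /det /dt; lia.
move=> z [t [/andP[t0 t1] e]].
have ez : (det p z r)%:~R = t * (det p q r)%:~R.
  by rewrite -!crossE e /cross /=; ring.
have : (0 < `|(det p z r)%:~R : R| < 1).
  rewrite ez normrM -intr_norm h mulr1 gtr0_norm //; exact/andP.
by rewrite -intr_norm ltr0z ltrz1; lia.
Qed.

Lemma edge_empty s p q : good_family R s -> edge s p q -> empty_seg p q.
Proof.
have h u v : good_family R s -> (u, v) \in s -> empty_seg u v.
  move=> [g _] /g[c e]; split=> //; apply/negP => /eqP uv.
  by move: c; rewrite /canon uv /= !ltnn andbF.
by move=> g /orP[/h|/h h']; [apply | apply/empty_seg_sym/h'].
Qed.

Lemma edge_nocross s p q a b : good_family R s -> edge s p q -> edge s a b ->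
  ~~ crossing p q a b.
Proof.
have h u v c d : good_family R s -> (u, v) \in s -> (c, d) \in s -> ~~ crossing u v c d.
  move=> [_ g] h1 h2; apply/negP => cr; have [x [hx hx']] := crossing_meet cr.
  apply: (g _ _ h1 h2 _ x); last by split.
  by case=> e1 e2; move: cr; rewrite e1 e2 crossing_self.
move=> g; rewrite /edge => /orP[h1|h1] /orP[h2|h2]; have := h _ _ _ _ g h1 h2 => //.
- by rewrite crossing_swapr.
- by rewrite crossing_swap.
- by rewrite crossing_swap crossing_swapr.
Qed.

Lemma good_family_add s p q : good_family R s -> canon (p, q) -> empty_seg p q ->
  (forall a b, edge s a b -> ~~ crossing p q a b) -> good_family R ((p, q) |: s).
Proof.
move=> gs cpq epq ncr; have [g1 g2] := gs.
have key a b (x : R * R) : (a, b) \in s -> (a, b) <> (p, q) ->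
    in_openseg (p, q) x -> in_openseg (a, b) x -> False.
  move=> hab ne h1 h2; have eab : edge s a b by rewrite /edge hab.
  have [cr|[e1 e2]|[e1 e2]] := meet_crossing epq (edge_empty gs eab) h1 h2.
  - by have := ncr _ _ eab; rewrite cr.
  - by apply: ne; rewrite e1 e2.
  - have [c _] := g1 _ hab; move: cpq c; rewrite e1 e2 /canon /=.
    by rewrite -!val_eqE; case: ltngtP => //= _; case: ltngtP.
split=> [e|e f].
  by rewrite !inE => /orP[/eqP->|/g1//]; split=> //; case: epq.
rewrite !inE => /orP[/eqP->|he] /orP[/eqP->|hf] ne x [h1 h2] //.
- by case: f hf ne h2 => a b hf ne h2; apply: (key a b x hf _ h1 h2) => h; apply: ne.
- by case: e he ne h1 => a b he ne h1; apply: (key a b x he _ h2 h1).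
- by apply: (g2 e f he hf ne x).
Qed.

Lemma maximal_edge s p q : triangulation R s -> empty_seg p q ->
  (forall a b, edge s a b -> ~~ crossing p q a b) -> edge s p q.
Proof.
move=> [gs mx]; have main u v : canon (u, v) -> empty_seg u v ->
    (forall a b, edge s a b -> ~~ crossing u v a b) -> edge s u v.
  move=> c e h; rewrite /edge; have := mx _ (good_family_add gs c e h) (subsetUr _ _).
  by move=> <-; rewrite setU11.
move=> e h; have [c|c] := orP (canon_total (proj1 e)); first exact: main.
rewrite edge_sym; apply: main => //; first exact: empty_seg_sym.
by move=> a b /h; rewrite crossing_swap.
Qed.

(** Both apexes are at the same height over [pq]; if they differed, a side of one triangle would
    cross a side of the other. *)
Lemma apex_unique s p q r r' : good_family R s ->
  edge s p q -> edge s p r -> edge s q r -> edge s p r' -> edge s q r' ->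
  `|det p q r| = 1 -> det p q r = det p q r' -> r = r'.
Proof.
move=> g epq epr eqr epr' eqr' h1 h2.
have n1 := edge_nocross g epr' eqr; have n2 := edge_nocross g epr eqr'.
have i1 : det p r' r = det p q r - det p q r' - det q r r' by rewrite /det /dt; ring.
have i2 : det p r' q = - det p q r' by rewrite /det /dt; ring.
have i3 : det p r q = - det p q r by rewrite /det /dt; ring.
have i4 : det p r r' = - det p r' r by rewrite /det /dt; ring.
have i5 : det q r p = det p q r by rewrite det_rot.
have i6 : det q r' p = det p q r' by rewrite det_rot.
have i7 : det q r' r = - det q r r' by rewrite /det /dt; ring.
have z : det p r' r = 0 by move: n1 n2; rewrite /crossing; nia.
have j1 : (px r' - px r) * det p q r = (px q - px p) * det p r' r - (px r - px p) * (det p q r - det p q r').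
  by rewrite /det /dt; ring.
have j2 : (py r' - py r) * det p q r = (py q - py p) * det p r' r - (py r - py p) * (det p q r - det p q r').
  by rewrite /det /dt; ring.
rewrite z h2 subrr !mulr0 subr0 -h2 in j1 j2.
have d0 : det p q r != 0 by lia.
move/eqP: j1; move/eqP: j2; rewrite !mulf_eq0 (negPf d0) !orbF !subr_eq0 => /eqP j2 /eqP j1.
exact: pt_ext.
Qed.

End EdgeGeometry.

(** A segment crossing a side that joins height 0 to height 1 does so strictly between these
    heights, so its endpoints, being at integer heights, lie on either side of the strip. *)
Lemma strip_straddle (u v ya yb c d : int) : u * v < 0 -> c = u * yb - ya * v ->
  d = c + v - u -> c * d < 0 -> (ya <= 0 /\ 0 < yb) \/ (yb <= 0 /\ 0 < ya).
Proof.
move=> h -> -> cd; have [h1|h1] := leP ya 0; have [h2|h2] := leP yb 0; [exfalso|by left|by right|exfalso].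
  by have [hu|hu] := ltP u 0; [have hv : 0 < v by nia | have hv : v < 0 by nia]; nia.
by have [hu|hu] := ltP u 0; [have hv : 0 < v by nia | have hv : v < 0 by nia]; nia.
Qed.

(** * Every edge has a triangle of determinant one on each side *)

Section Apex.

Variables (R : realFieldType) (n : nat).
Implicit Types (p q r a b m : pt n) (s t : {set seg n}).

(** Keeps the apex inside the box: it is a convex combination of the ends of the base and of a
    lattice point at height [h]. *)
Lemma convex_bound (N P Q B h beta : int) : 0 < h -> 0 <= beta <= h - 1 ->
  - N <= P <= N -> - N <= Q <= N -> - N <= B <= N ->
  forall X, h * X = (h - 1 - beta) * P + beta * Q + B -> - N <= X <= N.
Proof.
move=> h0 /andP[b0 b1] /andP[P1 P2] /andP[Q1 Q2] /andP[B1 B2] X e.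
have e1 : 0 <= (h - 1 - beta) * (N - P) + beta * (N - Q) + (N - B) by nia.
have e2 : 0 <= (h - 1 - beta) * (N + P) + beta * (N + Q) + (N + B) by nia.
apply/andP; split; nia.
Qed.

(** The coordinates [cx], [cy] send [p], [q], [m] to (0,0), (1,0), (0,1). The edges going through
    the strip form a [strip_family], and [r] is the separating point (j, 1). An edge crossing [pr]
    or [qr] would go through the strip, against separation, so maximality puts both sides in [s]. *)
Lemma apex_exists s p q m : triangulation R s -> edge s p q -> det p q m = 1 ->
  exists r, [/\ edge s p r, edge s q r & det p q r = 1].
Proof.
move=> tri epq hm; have gs := proj1 tri.
pose cx z := det p z m; pose cy z := det p q z.
have cdt a b c : dt (cx a) (cy a) (cx b) (cy b) (cx c) (cy c) = det a b c.
  by rewrite -[RHS]mul1r -hm /cx /cy /det /dt; ring.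
have cN0 a b : strip_N0 (cx a) (cy a) (cx b) (cy b) = det a b p.
  by rewrite -cdt /strip_N0 /cx /cy /det /dt; ring.
have cq a b : det a b q = det a b p - (cy b - cy a).
  by rewrite /cy /det /dt; ring.
pose F (f : pt n * pt n) := [&& edge s f.1 f.2, cy f.1 <= 0 & 0 < cy f.2].
have fam : strip_family F (fun f => cx f.1) (fun f => cy f.1) (fun f => cx f.2) (fun f => cy f.2).
  split=> [[a b] /and3P[/= eab ya yb]|[a b] [c d] /and3P[/= eab _ _] /and3P[/= ecd _ _]].
    split=> //; rewrite cN0.
    have := edge_nocross gs epq eab; rewrite /crossing cq -/(cy a) -/(cy b).
    have := cN0 a b; rewrite /strip_N0.
    move: (det a b p) (cy a) (cy b) (cx a) (cx b) ya yb => N ya yb xa xb ya0' yb0 h1 h2.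
    have [ya0|ya0] := ltP ya 0.
      have yab : ya * yb < 0 by nia.
      by move: h2; rewrite yab /= -leNgt => h2; clear h1; nia.
    have e0 : ya = 0 by lia.
    rewrite e0 mul0r subr0 in h1; rewrite e0 subr0 -h1 {h1 h2}.
    by have [hx|hx] := leP xa 0; [left|right]; nia.
  rewrite !cdt => -[h1 h2]; have := edge_nocross gs eab ecd.
  by rewrite /crossing h1 h2.
have [j sep hj] := strip_sep_exists fam.
have [r [rx ry]] : exists r, px r = px p + j * (px q - px p) + (px m - px p) /\
    py r = py p + j * (py q - py p) + (py m - py p).
  case: hj => [->|[[a b] /and3P[/= eab ya yb] hj]].
    by exists m; split; ring.
  have hb : 0 <= j * cy b - cx b <= cy b - 1 by lia.
  apply: pt_exists.
    apply: (convex_bound yb hb (px_bound p) (px_bound q) (px_bound b)).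
    have : (px b - px p) * det p q m = cx b * (px q - px p) + cy b * (px m - px p).
      by rewrite /cx /cy /det /dt; ring.
    by rewrite hm mulr1 => e; rewrite -[px b](subrK (px p)) e; ring.
  apply: (convex_bound yb hb (py_bound p) (py_bound q) (py_bound b)).
  have : (py b - py p) * det p q m = cx b * (py q - py p) + cy b * (py m - py p).
    by rewrite /cx /cy /det /dt; ring.
  by rewrite hm mulr1 => e; rewrite -[py b](subrK (py p)) e; ring.
have hr : det p q r = 1 by rewrite -hm /det /dt rx ry; ring.
have cr a b : det a b r = strip_N1 (cx a) (cy a) (cx b) (cy b) - j * (cy b - cy a).
  rewrite -cdt.
  have -> : cx r = j by rewrite -[RHS]mulr1 -hm /cx /det /dt rx ry; ring.
  by rewrite [cy r]hr /strip_N1 /dt; ring.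
have sepE a b : F (a, b) -> 0 <= det a b p * det a b r /\ 0 <= det a b q * det a b r.
  move=> Fab; have /= := sep _ Fab; have [_ _] := proj1 fam _ Fab.
  move: Fab => /and3P[/= eab ya yb]; rewrite cq cr /= cN0.
  move: (strip_N1 _ _ _ _) (det a b p) => N1 N0 h [h1 h2].
  by case: h => h; [move: (h1 h) | move: (h2 h)] => h3; nia.
have straddle a b : edge s a b -> (cy a <= 0 /\ 0 < cy b) \/ (cy b <= 0 /\ 0 < cy a) ->
    0 <= det a b p * det a b r /\ 0 <= det a b q * det a b r.
  move=> eab [[h1 h2]|[h1 h2]].
    by apply: sepE; rewrite /F /= eab h1.
  have -> : det a b p = - det b a p by rewrite det_swap.
  have -> : det a b q = - det b a q by rewrite det_swap.
  have -> : det a b r = - det b a r by rewrite det_swap.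
  by rewrite !mulrNN; apply: sepE; rewrite /F /= edge_sym eab h1.
exists r; split=> //.
  apply: (maximal_edge tri).
    by apply: (@unimodular_empty R n p r q); have : det p r q = - det p q r by [rewrite /det /dt; ring]; lia.
  move=> a b eab; apply/negP => /andP[h1 h2].
  have [] := straddle a b eab; last by lia.
  apply: (@strip_straddle (- det p r a) (- det p r b) (cy a) (cy b) (det a b p) (det a b r)) => //.
  - by rewrite mulrNN.
  - by rewrite -[LHS]mulr1 -hr /cy /det /dt; ring.
  - by rewrite /det /dt; ring.
apply: (maximal_edge tri).
  by apply: (@unimodular_empty R n q r p); rewrite det_rot hr.
move=> a b eab; apply/negP => /andP[h1 h2].
have [] := straddle a b eab; last by lia.
apply: (@strip_straddle (- det q r a) (- det q r b) (cy a) (cy b) (det a b q) (det a b r)) => //.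
- by rewrite mulrNN.
- by rewrite -[LHS]mulr1 -hr /cy /det /dt; ring.
- by rewrite /det /dt; ring.
Qed.

End Apex.

(** * Longest sides of triangles and the parallelograms they span *)

(** The sum u + v has determinant 0 with d, and d is primitive, so u + v = j d. The boxes leave j in
    {0, 1, 2}; the extreme values force u = 0 or u = d, against the determinant. *)
Lemma unimodular_sum (d1 d2 u1 u2 v1 v2 e : int) : `|e| = 1 ->
  btw 0 u1 d1 -> btw 0 u2 d2 -> btw 0 v1 d1 -> btw 0 v2 d2 ->
  d1 * u2 - d2 * u1 = e -> d1 * v2 - d2 * v1 = - e -> u1 + v1 = d1 /\ u2 + v2 = d2.
Proof.
move=> he hu1 hu2 hv1 hv2 eu ev.
pose j := e * ((u1 + v1) * u2 - (u2 + v2) * u1).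
have ee : e * e = 1 by nia.
have ew : d1 * (u2 + v2) = d2 * (u1 + v1) by lia.
have j1 : d1 * j = u1 + v1.
  rewrite /j; transitivity (e * ((u1 + v1) * (d1 * u2) - d1 * (u2 + v2) * u1)); first by ring.
  by rewrite ew -[RHS]mul1r -ee -{3}eu; ring.
have j2 : d2 * j = u2 + v2.
  rewrite /j; transitivity (e * (d2 * (u1 + v1) * u2 - (u2 + v2) * (d2 * u1))); first by ring.
  by rewrite -ew -[RHS]mul1r -ee -{3}eu; ring.
rewrite -j1 -j2.
have d0 : (d1 != 0) || (d2 != 0) 
  by rewrite -negb_and; apply/negP => /andP[/eqP a1 /eqP a2]; move: eu he; rewrite a1 a2; lia.
clearbody j; rewrite /btw in hu1 hu2 hv1 hv2.
have jb : (j == 0) || (j == 1) || (j == 2) by case/orP: d0 => d0; nia.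
case/orP: jb => [/orP[|]|] /eqP ej; last 2 first.
- by rewrite ej !mulr1.
- have [z1 z2] : u1 = d1 /\ u2 = d2 by lia.
  by move: eu he; rewrite z1 z2; lia.
have : u1 = 0 /\ u2 = 0 by rewrite ej !mulr0 in j1 j2; lia.
by case=> z1 z2; move: eu he; rewrite z1 z2; lia.
Qed.

Section Triangles.

Variables (R : realFieldType) (n : nat).
Implicit Types (p q r a b m : pt n) (s t : {set seg n}).

Definition middle p m q : bool := btw (px p) (px m) (px q) && btw (py p) (py m) (py q).

(* The vertex [m] lies in the bounding box of [p] and [q], so [pq] is the longest
   side for the l1 length. *)
Definition tri s p m q : bool :=
  [&& edge s p m, edge s m q, edge s p q, `|det p m q| == 1 & middle p m q].

Definition len p q : nat := (`|px p - px q|%N + `|py p - py q|%N)%N.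

Definition par p m m' q : bool :=
  (px p + px q == px m + px m') && (py p + py q == py m + py m').

Lemma len_sym p q : len p q = len q p.
Proof. by rewrite /len; lia. Qed.

Lemma len_gt0 p q : p != q -> (0 < len p q)%N.
Proof.
move=> h; rewrite lt0n; apply: contra h => /eqP h; apply/eqP/pt_ext; rewrite /len in h; lia.
Qed.

Lemma len_middle p m q : middle p m q -> len p q = (len p m + len m q)%N.
Proof. by rewrite /middle /btw /len; lia. Qed.

Lemma middle_sym p m q : middle p m q = middle q m p.
Proof. by rewrite /middle /btw; congr (_ && _); exact: orbC. Qed.

Lemma tri_det s p m q : tri s p m q -> `|det p q m| = 1.
Proof.
by case/and5P=> _ _ _ /eqP h _; have : det p q m = - det p m q by [rewrite /det /dt; ring]; lia.
Qed.

Lemma apex_tri s a b r : edge s a b -> edge s a r -> edge s b r -> `|det a b r| = 1 ->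
  [\/ tri s a r b, tri s a b r | tri s r a b].
Proof.
move=> eab ear ebr h.
have [h1|h2|h3] := or3P (unimodular_middle h).
- by constructor 2; rewrite /tri eab ear ebr h eqxx.
- constructor 1; rewrite /tri eab ear [edge s r b]edge_sym ebr middle_sym /middle h2 andbT /=.
  by rewrite (_ : det a r b = - det a b r) ?normrN ?h //; rewrite /det /dt; ring.
- by constructor 3; rewrite /tri eab ![edge s r _]edge_sym ear ebr /middle h3 -det_rot h.
Qed.

Lemma apex_side s a b m : triangulation R s -> edge s a b -> `|det a b m| = 1 ->
  exists r, [/\ edge s a r, edge s b r & det a b r = det a b m].
Proof.
move=> ts eab h; have [e|e] : det a b m = 1 \/ det b a m = 1 by rewrite [det b a m]det_swap; lia.
  by have [r [? ? ?]] := apex_exists ts eab e; exists r; split=> //; rewrite e.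
rewrite edge_sym in eab; have [r [? ? e']] := apex_exists ts eab e; exists r; split=> //.
by rewrite det_swap e' -e -det_swap.
Qed.

(** The box of [p] and [q] is symmetric about their midpoint. The reflected point certifies that
    there is room for a triangle on the other side of [pq]. *)
Lemma par_exists p m q : middle p m q -> exists m', par p m m' q.
Proof.
rewrite /middle /btw => h.
have [||m' [e1 e2]] := @pt_exists n (px p + px q - px m) (py p + py q - py m).
- by have := px_bound p; have := px_bound q; lia.
- by have := py_bound p; have := py_bound q; lia.
- by exists m'; rewrite /par e1 e2; apply/andP; split; apply/eqP; ring.
Qed.

Lemma par_coords p m m' q : par p m m' q ->
  px q = px m + px m' - px p /\ py q = py m + py m' - py p.
Proof. by case/andP=> /eqP <- /eqP <-; split; ring. Qed.

Lemma par_detE p m m' q : par p m m' q ->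
  [/\ det p q m' = - det p q m, det p m m' = det p m q & det p m' q = - det p m q].
Proof.
case/par_coords=> ex ey.
by rewrite /det /dt ex ey; split; ring.
Qed.

(** By the reflection of [m], the edge [ab] has a second triangle, so it is never on the boundary of
    the box. In the discharging this second triangle either makes [ab] longest on both sides or pays
    a charge to it. *)
Lemma tri_next s a m b : triangulation R s -> tri s a m b ->
  [\/ exists2 r, tri s a r b & r != m, exists r, tri s a b r | exists r, tri s r a b].
Proof.
move=> ts t; have h := tri_det t; case/and5P: t => _ _ eab _ mid.
have [m' pm] := par_exists mid; have [e _ _] := par_detE pm.
have [|r [ear ebr er]] := apex_side ts eab (m := m'); first by rewrite e normrN.
have [|t|t|t] := apex_tri eab ear ebr; first by rewrite er e normrN.
- constructor 1; exists r => //; apply/eqP => rm; move: er; rewrite rm; lia.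
- by constructor 2; exists r.
- by constructor 3; exists r.
Qed.

Lemma tri_eq_side s p q m m' : triangulation R s -> tri s p m q -> tri s p m' q ->
  det p q m = det p q m' -> m = m'.
Proof.
move=> ts t t' e; have h := tri_det t.
case/and5P: t => e1 e2 e3 _ _; case/and5P: t' => e4 e5 _ _ _.
by apply: (apex_unique (proj1 ts) e3) => //; rewrite edge_sym.
Qed.

Lemma tri_par s p m m' q : triangulation R s -> tri s p m q -> tri s p m' q ->
  m != m' -> par p m m' q.
Proof.
move=> ts t t' mm; have h := tri_det t; have h' := tri_det t'.
have e : det p q m' = - det p q m.
  have : det p q m != det p q m' by apply: contra mm => /eqP/(tri_eq_side ts t t')->.
  by lia.
have /and5P[_ _ _ _ /andP[m1 m2]] := t; have /and5P[_ _ _ _ /andP[m3 m4]] := t'.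
have sh (x y z : int) : btw x y z -> btw 0 (y - x) (z - x) by rewrite /btw; lia.
have [z1 z2] := unimodular_sum h (sh _ _ _ m1) (sh _ _ _ m2) (sh _ _ _ m3) (sh _ _ _ m4) erefl e.
by rewrite /par; apply/andP; split; apply/eqP; lia.
Qed.

Lemma in_seg_of_line p m a b : det a b m = 0 -> det p m a * det p m b < 0 ->
  in_seg (ptR R a) (ptR R b) (ptR R m).
Proof.
move=> h0 hlt.
pose A := (det p m a)%:~R : R; pose B := (det p m b)%:~R : R.
have AB : A * B < 0 by rewrite /A /B -intrM ltrz0.
have BA : B - A != 0 by apply/negP => /eqP/subr0_eq e; move: AB; rewrite e ltNge -expr2 sqr_ge0.
have e1 : (px m - px a) * (det p m b - det p m a) = - det p m a * (px b - px a) - (px m - px p) * det a b m.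
  by rewrite /det /dt; ring.
have e2 : (py m - py a) * (det p m b - det p m a) = - det p m a * (py b - py a) - (py m - py p) * det a b m.
  by rewrite /det /dt; ring.
rewrite h0 !mulr0 subr0 in e1 e2; rewrite subr0 in e2.
have cast (x y u v w z : int) : (x - y) * (v - u) = - u * (w - z) ->
    (x%:~R - y%:~R) * (v%:~R - u%:~R) = - u%:~R * (w%:~R - z%:~R) :> R.
  by move=> e; rewrite -!intrB -intrM e intrM intrN.
exists (- A / (B - A)); split.
  have [A0|A0] := ltP A 0.
    have B0 : 0 < B by move: AB; rewrite nmulr_rlt0.
    by rewrite divr_gt0 /= ?ltr_pdivrMr ?mul1r ?oppr_gt0; lra.
  have A1 : 0 < A by rewrite lt_neqAle A0 andbT; apply/eqP => z; move: AB; rewrite -z mul0r ltxx.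
  have B0 : B < 0 by move: AB; rewrite pmulr_rlt0.
  rewrite -[B - A]opprB invrN mulrNN.
  by rewrite divr_gt0 /= ?ltr_pdivrMr ?mul1r; lra.
apply: injective_projections; rewrite /= -/(px m) -/(py m) -/(px a) -/(px b) -/(py a) -/(py b);
  apply/eqP; rewrite addrC -subr_eq; apply/eqP/(mulIf BA); rewrite mulrAC divfK //; exact: cast.
Qed.

(** In the coordinates [x], [y] the parallelogram is the unit square with [p] = (0,0), [m] = (1,0),
    [m'] = (0,1), [q] = (1,1). Applying [unit_square_exit] once as is, and once with the coordinates
    and the endpoints exchanged, pins [a] to [m] and [b] to [m']. *)
Lemma par_diag p m m' q a b : par p m m' q -> `|det p m m'| = 1 -> empty_seg R a b ->
  crossing p q a b -> ~~ crossing p m a b -> ~~ crossing m q a b ->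
  ~~ crossing p m' a b -> ~~ crossing m' q a b ->
  (a = m /\ b = m') \/ (a = m' /\ b = m).
Proof.
wlog hD : m m' / det p m m' = 1.
  move=> wl pr h eab c0 c1 c2 c3 c4; have [e|e] : det p m m' = 1 \/ det p m' m = 1.
      by have : det p m' m = - det p m m' by [rewrite /det /dt; ring]; lia.
    by apply: (wl m m').
  have [||h'|h'] := wl m' m e _ _ eab c0 c3 c4 c1 c2; try by [right|left].
    by move: pr; rewrite /par ![px m + _]addrC ![py m + _]addrC.
  by rewrite e.
wlog hab : a b / det p q a < 0.
  move=> wl pr h eab c0 c1 c2 c3 c4; have [e|e] : det p q a < 0 \/ det p q b < 0.
      by move: c0 => /andP[]; move: (det p q a) (det p q b) => *; nia.
    by apply: (wl a b).
  have := wl b a e pr h (empty_seg_sym eab).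
  rewrite (crossing_swapr p q a b) (crossing_swapr p m a b) (crossing_swapr m q a b).
  rewrite (crossing_swapr p m' a b) (crossing_swapr m' q a b).
  by move=> /(_ c0 c1 c2 c3 c4) [[-> ->]|[-> ->]]; [right|left].
move=> pr _ [_ eab] /andP[c0 c0'] c1 c2 c3 c4.
have [qx qy] := par_coords pr.
pose x z := det p z m'; pose y z := det p m z.
have cp c d : det c d p = x c * y d - y c * x d.
  by rewrite -[LHS]mul1r -hD /x /y /det /dt; ring.
have cm c d : det c d m = x c * y d - y c * x d - (y d - y c).
  by rewrite -cp /y /det /dt; ring.
have cm' c d : det c d m' = x c * y d - y c * x d + (x d - x c).
  by rewrite -cp /x /det /dt; ring.
have cq c d : det c d q = x c * y d - y c * x d + (x d - x c) - (y d - y c).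
  by rewrite -cp /x /y /det /dt qx qy; ring.
have lq c : det p q c = y c - x c by rewrite /x /y /det /dt qx qy; ring.
have lmq c : det m q c = - (x c - 1).
  by rewrite -hD /x /y /det /dt qx qy; ring.
have lm' c : det p m' c = - x c by rewrite /x /det /dt; ring.
have lmq' c : det m' q c = y c - 1.
  by rewrite -hD /x /y /det /dt qx qy; ring.
rewrite lq in hab; rewrite !lq in c0; rewrite cp cq in c0'.
have hb : x b < y b by move: c0 hab; clear; nia.
have ptc c d : x c = x d -> y c = y d -> c = d.
  move=> ex ey; apply: pt_ext.
    have e z : px z - px p = x z * (px m - px p) + y z * (px m' - px p).
      by rewrite -[LHS]mul1r -hD /x /y /det /dt; ring.
    by have := e c; rewrite ex ey -e; lia.
  have e z : py z - py p = x z * (py m - py p) + y z * (py m' - py p).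
    by rewrite -[LHS]mul1r -hD /x /y /det /dt; ring.
  by have := e c; rewrite ex ey -e; lia.
have xm : x m = 1 by rewrite /x hD.
have ym : y m = 0 by rewrite /y /det /dt; ring.
have xm' : x m' = 0 by rewrite /x /det /dt; ring.
have ym' : y m' = 1 by rewrite /y hD.
have [xa ya] : x a = 1 /\ y a = 0.
  apply: (@unit_square_exit (x a) (y a) (x b) (y b)) => //.
  - by rewrite -subr_lt0.
  - by move=> [z1 z2]; case/negP: c1; rewrite /crossing cp cm; apply/andP; split.
  - by move=> [z1 z2]; case/negP: c2; rewrite /crossing cm cq !lmq mulrNN; apply/andP; split.
  - by move=> [z1 z2]; apply: (eab m); apply: (@in_seg_of_line p); rewrite ?cm.
have [yb xb] : y b = 1 /\ x b = 0.
  have eD : y b * x a - x b * y a = x a * y b - y a * x b by ring.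
  apply: (@unit_square_exit (y b) (x b) (y a) (x a)).
  - exact: hb.
  - by rewrite -subr_lt0.
  - by move: c0'; congr (is_true (_ < 0)); ring.
  - move=> [z1 z2]; case/negP: c3; rewrite /crossing cp cm' !lm' mulrNN.
    by rewrite mulrC z2 -eD (_ : x b - x a = - (x a - x b)) ?z1 //; ring.
  - move=> [z1 z2]; case/negP: c4; rewrite /crossing cm' cq !lmq' mulrC z2 /= -eD.
    by move: z1; congr (is_true (_ < 0)); ring.
  - move=> [z1 z2]; apply: (eab m'); apply: (@in_seg_of_line p); last by rewrite !lm' mulrNN mulrC.
    by rewrite cm' -eD -[RHS]z1; ring.
by left; split; apply: ptc; rewrite ?xa ?ya ?xb ?yb.
Qed.

End Triangles.

(** With absolute coordinates (a, b) and (c, d), equal lengths give c = a + b - d, and the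
    determinant becomes (a + b)(d - b) up to sign: the common length divides 1. *)
Lemma farey_balanced (u1 u2 v1 v2 : int) : `|u1 * v2 - u2 * v1| = 1 ->
  btw 0 u1 (u1 + v1) -> btw 0 u2 (u2 + v2) -> `|v1| + `|v2| = `|u1| + `|u2| ->
  `|u1| + `|u2| = 1.
Proof.
move=> hd h1 h2.
have sgn (u v : int) : btw 0 u (u + v) ->
    exists e a c, [/\ e = 1 \/ e = -1, 0 <= a, 0 <= c, u = e * a & v = e * c].
  rewrite /btw => h; case: (leP 0 (u + v)) => h'.
    by exists 1, u, v; split; lia.
  by exists (-1), (- u), (- v); split; lia.
have [e [a [c [he a0 c0 ea ec]]]] := sgn _ _ h1.
have [f [b [d [hf b0 d0 eb ed]]]] := sgn _ _ h2.
rewrite {}ea {}eb {}ec {}ed {sgn h1 h2} in hd * => hl.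
have {}hl : c = a + b - d by case: he hf hl => -> [] ->; lia.
have : `|(a + b) * (b - d)| = 1.
  have -> : (a + b) * (b - d) = - (e * e) * (f * f) * ((a + b) * (d - b)).
    by case: he hf => -> [] ->; ring.
  have -> : - (e * e) * (f * f) * ((a + b) * (d - b)) =
      - (e * f) * (e * a * (f * d) - f * b * (e * (a + b - d))) by ring.
  by rewrite normrM -hl hd; case: he hf => -> [] ->.
suff -> : `|e * a| + `|f * b| = a + b.
  have : 0 <= a + b by lia.
  move: (a + b) (b - d) => z t z0; rewrite normrM (ger0_norm z0) => h.
  have : 0 <= `|t| by [].
  move: `|t| h => y h y0; have y1 : 0 < y by nia.
  have z1 : 0 < z by nia.
  by nia.
by case: he hf => -> [] ->; lia.
Qed.

Lemma farey_mediant (x y : nat) : coprime x y -> (0 < x)%N -> (0 < y)%N ->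
  exists u v : nat, [/\ (u <= x)%N, (v <= y)%N & (x * v = y * u + 1)%N].
Proof.
move=> cxy x0 y0; case: (egcdnP y x0) => km kn e h.
move: cxy; rewrite /coprime => /eqP g; rewrite g in e h.
exists kn, km; have : (kn.+1 * y <= x * y)%N by rewrite leq_mul2r; lia.
by split; nia.
Qed.

(** * Flips *)

Section Flips.

Variables (R : realFieldType) (n : nat).
Implicit Types (p q r a b c d m : pt n) (s t : {set seg n}).

(* The strict inequality excludes unit squares and chooses which of the two middle
   vertices is called [m]. *)
Definition flippable s p m m' q : bool :=
  [&& tri s p m q, tri s p m' q, par p m m' q & (len p m' < len p m)%N].

(* The same parallelogram, now cut by its short diagonal [mm']. *)
Definition up s p m m' q : bool := [&& tri s p m' m, tri s m' m q & par p m m' q].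

Definition cseg a b : seg n := if canon (a, b) then (a, b) else (b, a).

Definition flip s p m m' q : {set seg n} := cseg m m' |: (s :\ cseg p q).

Lemma cseg_cases a b : cseg a b = (a, b) \/ cseg a b = (b, a).
Proof. by rewrite /cseg; case: ifP; [left|right]. Qed.

Lemma cseg_eq a b c d : cseg a b = cseg c d -> (a = c /\ b = d) \/ (a = d /\ b = c).
Proof.
by case: (cseg_cases a b) => ->; case: (cseg_cases c d) => -> [-> ->]; [left|right|right|left].
Qed.

Lemma canon_cseg a b : a != b -> canon (cseg a b).
Proof. by move=> /canon_total; rewrite /cseg; case: ifP. Qed.

Lemma canon_csegE e : canon e -> cseg e.1 e.2 = e.
Proof. by case: e => a b /= c; rewrite /cseg c. Qed.

Lemma cseg_sym a b : cseg a b = cseg b a.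
Proof.
have [->//|ab] := eqVneq a b.
rewrite /cseg; have := canon_total ab; case: ifP => [c _|_ /= ->//].
suff -> : canon (b, a) = false by [].
apply: negbTE; move: c; rewrite /canon /= -!val_eqE.
by case: ltngtP => //= _; case: ltngtP.
Qed.

Lemma elen_cseg a b : elen (cseg a b) = len a b.
Proof. by case: (cseg_cases a b) => ->; rewrite // len_sym. Qed.

Lemma edge_cseg s a b : good_family R s -> edge s a b = (cseg a b \in s).
Proof.
move=> [g _]; apply/idP/idP; last first.
  by rewrite /edge; case: (cseg_cases a b) => -> ->; rewrite ?orbT.
case/orP=> h; have [c _] := g _ h; last rewrite cseg_sym.
  by rewrite (canon_csegE c).
by rewrite (canon_csegE c).
Qed.

Lemma edge_neq s a b : good_family R s -> edge s a b -> a != b.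
Proof. by move=> g /(edge_empty g) []. Qed.

Lemma good_family_sub s t : good_family R t -> s \subset t -> good_family R s.
Proof.
move=> [g1 g2] /subsetP st; split=> [e /st/g1//|e f /st he /st hf]; exact: g2.
Qed.

(** As [pm'] is the shorter side, [farey_reduce] puts [m'] in the box of [p] and [m]; lengths then
    add along p, m', m, which gives the excess of [pq] over [mm']. *)
Lemma flippable_facts s p m m' q : flippable s p m m' q ->
  [/\ crossing p q m m', `|det p m m'| = 1, middle p m' m, middle m' m q &
      len p q = (len m m' + 2 * len p m')%N].
Proof.
case/and4P => t1 t2 pr hl; have [d1 d2 d3] := par_detE pr.
have [_ _ _ /eqP h mid] := and5P t1; have [_ _ _ _ mid'] := and5P t2.
have e1 : det m m' p = det p m m' by rewrite det_rot.
have e2 : det p q m = - det p m q by rewrite /det /dt; ring.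
have [ex ey] := par_coords pr.
have e3 : det m m' q = - det p m m'.
  by rewrite /det /dt ex ey; ring.
have b1 : middle p m' m.
  have := @farey_reduce (px m - px p) (py m - py p) (px q - px m) (py q - py m).
  move: h mid hl; rewrite /det /dt /middle /btw /len => h mid hl.
  move/(_ _); rewrite -[in X in X -> _]h; move=> /(_ _ _ _ _).
  have -> : (px m - px p) * (py q - py m) - (py m - py p) * (px q - px m) =
    (px m - px p) * (py q - py p) - (py m - py p) * (px q - px p) by ring.
  by move=> /(_ erefl); lia.
have b2 : middle m' m q by move: b1 mid; rewrite /middle /btw; lia.
split=> //.
- by rewrite /crossing d1 e1 e2 e3 d2; nia.
- by rewrite d2.
- by move: b1 mid mid'; rewrite /middle /btw /len; lia.
Qed.

Lemma flip_edge s p m m' q a b : good_family R s -> edge s a b ->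
  ~ ((a = p /\ b = q) \/ (a = q /\ b = p)) -> edge (flip s p m m' q) a b.
Proof.
move=> g; rewrite (edge_cseg _ _ g) => h ne.
have : cseg a b \in flip s p m m' q.
  by rewrite !inE h andbT; apply/orP; right; apply/eqP => /cseg_eq.
by rewrite /edge; case: (cseg_cases a b) => -> ->; rewrite ?orbT.
Qed.

(** [par_diag] is used twice. With the diagonals exchanged, it shows that an old edge crossing [mm']
    must be [pq]. For maximality, it shows that a segment compatible with the new family but not
    with [s] crosses [pq] and must be [mm']. *)
Lemma flip_triangulation s p m m' q : triangulation R s -> flippable s p m m' q ->
  triangulation R (flip s p m m' q).
Proof.
move=> ts rt; have [cr h1 _ _ _] := flippable_facts rt; have [gs mx] := ts.
case/and4P: rt => /and5P[epm emq epq _ _] /and5P[epm' em'q _ _ _] pr _.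
have [d1 d2 d3] := par_detE pr.
have mm' : m != m' by apply/negP => /eqP e; move: h1; rewrite e /det /dt; lia.
have emp : empty_seg R m m' by apply: (@unimodular_empty R n m m' p); rewrite det_rot.
have npm := edge_neq gs epm; have npm' := edge_neq gs epm'.
have nmq := edge_neq gs emq; have nm'q := edge_neq gs em'q; have npq := edge_neq gs epq.
have side a b : edge s a b -> a \in [:: m; m'] \/ b \in [:: m; m'] -> edge (flip s p m m' q) a b.
  move=> eab h; apply: flip_edge => // -[[e1 e2]|[e1 e2]]; subst a b; case: h; rewrite !inE;
    by rewrite ?(negPf npm) ?(negPf npm') ?[q == _]eq_sym ?(negPf nmq) ?(negPf nm'q).
have s0good : good_family R (s :\ cseg p q) by apply: good_family_sub gs (subsetDl _ _).
have good' : good_family R (flip s p m m' q).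
  have ncr a b : edge (s :\ cseg p q) a b -> ~~ crossing m m' a b.
    rewrite (edge_cseg _ _ s0good) !inE -(edge_cseg _ _ gs).
    case/andP=> /eqP ne eab; apply/negP => crab.
    have [||||||[e1 e2]|[e1 e2]] := @par_diag R n m p q m' a b _ _ (edge_empty gs eab) crab.
    + by case/andP: pr => /eqP hx /eqP hy; rewrite /par hx hy !eqxx.
    + by have -> : det m p q = - det p m q by [rewrite /det /dt; ring]; rewrite normrN -d2.
    + by rewrite crossing_swap; apply: edge_nocross gs epm eab.
    + by apply: edge_nocross gs epm' eab.
    + by apply: edge_nocross gs emq eab.
    + by rewrite crossing_swap; apply: edge_nocross gs em'q eab.
    + by apply: ne; rewrite e1 e2.
    + by apply: ne; rewrite e1 e2 cseg_sym.
  rewrite /flip; have [e|e] := cseg_cases m m'; have := canon_cseg mm'; rewrite e => c.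
    exact: good_family_add.
  apply: good_family_add => //; first exact: empty_seg_sym.
  by move=> a b /ncr; rewrite crossing_swap.
split=> // t gt st; apply/eqP; rewrite eqEsubset st andbT; apply/subsetP => -[a b] abt.
have eabt : edge t a b by rewrite /edge abt.
have sub c d : edge (flip s p m m' q) c d -> edge t c d.
  by rewrite /edge => /orP[] /(subsetP st) ->; rewrite ?orbT.
have [cab eab] := proj1 gt _ abt.
have emm' : edge (flip s p m m' q) m m' by rewrite (edge_cseg _ _ good') setU11.
apply: contraT => nab.
have abs : (a, b) \in s.
  have <- : (a, b) |: s = s; last by rewrite setU11.
  apply: mx; last exact: subsetUr.
  apply: good_family_add => // [|c d ecd]; first exact: edge_empty gt eabt.
  apply/negP => crab.
  have [e|ne] := eqVneq (cseg c d) (cseg p q); last first.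
    have : edge t c d.
      apply/sub/flip_edge => // -[[e1 e2]|[e1 e2]]; case/eqP: ne; rewrite e1 e2 //.
      exact: cseg_sym.
    by move/(edge_nocross gt eabt); rewrite crab.
  have crpq : crossing p q a b.
    by rewrite crossing_sym; case: (cseg_eq e) => -[<- <-] //; rewrite crossing_swapr.
  have [||||[e1 e2]|[e1 e2]] := par_diag pr h1 (edge_empty gt eabt) crpq.
  - by apply: (edge_nocross gt _ eabt); apply/sub/side => //; right; rewrite !inE eqxx.
  - by apply: (edge_nocross gt _ eabt); apply/sub/side => //; left; rewrite !inE eqxx.
  - by apply: (edge_nocross gt _ eabt); apply/sub/side => //; right; rewrite !inE eqxx orbT.
  - by apply: (edge_nocross gt _ eabt); apply/sub/side => //; left; rewrite !inE eqxx orbT.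
  - by move: nab; rewrite -(canon_csegE cab) /= e1 e2 -(edge_cseg _ _ good') emm'.
  - by move: nab; rewrite -(canon_csegE cab) /= e1 e2 cseg_sym -(edge_cseg _ _ good') emm'.
(* The segment is in [s] but was lost in the flip, so it is the old diagonal, which crosses the new
   one. *)
have abE : cseg a b = cseg p q.
  by apply/eqP; apply: contraR nab => h; rewrite !inE abs andbT -(canon_csegE cab) h orbT.
have := edge_nocross gt (sub _ _ emm') eabt.
suff -> : crossing m m' a b by [].
by rewrite -crossing_sym; case: (cseg_eq abE) => -[-> ->] //; rewrite crossing_swap.
Qed.

Lemma flip_up s p m m' q : triangulation R s -> flippable s p m m' q -> up (flip s p m m' q) p m m' q.
Proof.
move=> ts rt; have [cr h1 b1 b2 _] := flippable_facts rt; have gs := proj1 ts.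
have good' := proj1 (flip_triangulation ts rt).
case/and4P: rt => /and5P[epm emq epq _ _] /and5P[epm' em'q _ _ _] pr _.
have [d1 d2 d3] := par_detE pr.
have npm := edge_neq gs epm; have npm' := edge_neq gs epm'.
have nmq := edge_neq gs emq; have nm'q := edge_neq gs em'q.
have emm' : edge (flip s p m m' q) m m' by rewrite (edge_cseg _ _ good') setU11.
have f1 : det p m' m = - det p m m' by rewrite /det /dt; ring.
have f2 : det m' m q = det m m' p.
  have [ex ey] := par_coords pr.
  by rewrite /det /dt ex ey; ring.
rewrite /up /tri b1 b2 pr f1 normrN f2 (det_rot p) h1 !eqxx [edge _ m' m]edge_sym emm' /=.
rewrite !flip_edge // => -[[e1 e2]|[e1 e2]].
all: by move: npm npm' nmq nm'q; rewrite -?e1 -?e2 ?eqxx // ?e1 ?e2 ?eqxx.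
Qed.

Lemma flip_notin s p m m' q : good_family R s -> flippable s p m m' q ->
  cseg p q \in s /\ cseg m m' \notin s.
Proof.
move=> gs rt; have [cr _ _ _ _] := flippable_facts rt.
case/and4P: rt => /and5P[_ _ epq _ _] _ _ _; rewrite -!(edge_cseg _ _ gs) epq; split=> //.
by apply/negP => e; have := edge_nocross gs epq e; rewrite cr.
Qed.

Lemma flip_tlen s p m m' q : good_family R s -> flippable s p m m' q ->
  tlen s = (tlen (flip s p m m' q) + 2 * len p m')%N.
Proof.
move=> gs rt; have [i1 i2] := flip_notin gs rt; have [_ _ _ _ e] := flippable_facts rt.
rewrite /tlen /flip (big_setD1 _ i1) /= big_setU1 /=; last by rewrite !inE negb_and i2 orbT.
by rewrite !elen_cseg e addnAC.
Qed.

Lemma flipK s p m m' q : good_family R s -> flippable s p m m' q ->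
  flip (flip s p m m' q) m p q m' = s.
Proof.
move=> gs rt; have [i1 i2] := flip_notin gs rt.
rewrite /flip setU1K ?setD1K //; by rewrite !inE negb_and i2 orbT.
Qed.

(** An empty segment has coprime coordinate differences, both nonzero once the length exceeds 1; a
    small Bezout relation between them is a lattice point of the box at determinant one. *)
Lemma edge_mediant s a b : good_family R s -> edge s a b -> (1 < len a b)%N ->
  exists2 m, `|det a b m| = 1 & middle a m b.
Proof.
move=> gs eab l2; have [ab emp] := edge_empty gs eab.
pose x := px b - px a; pose y := py b - py a.
have hx1 := px_bound a; have hx2 := px_bound b.
have hy1 := py_bound a; have hy2 := py_bound b.
have sgn (z : int) : exists e : int, z = e * (absz z)%:Z /\ (e = 1 \/ e = -1).
  by case: (leP 0 z) => h; [exists 1 | exists (-1)]; lia.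
have [e1 [ex sx]] := sgn x; have [e2 [ey sy]] := sgn y.
(* A common divisor g > 1 would put a lattice point inside the edge, at parameter 1/g. *)
have cop : coprime (absz x) (absz y).
  rewrite /coprime; apply/negPn/negP => g1.
  set g := gcdn (absz x) (absz y) in g1.
  have g0 : (0 < g)%N.
    rewrite gcdn_gt0; move: l2; rewrite /len -/x -/y /x /y; lia.
  have [x' ex'] := dvdnP (dvdn_gcdl (absz x) (absz y)).
  have [y' ey'] := dvdnP (dvdn_gcdr (absz x) (absz y)).
  rewrite -/g in ex' ey'.
  have [X eX] : exists X : int, x = X * g%:Z by exists (e1 * x'%:Z); rewrite {1}ex ex' PoszM mulrA.
  have [Y eY] : exists Y : int, y = Y * g%:Z by exists (e2 * y'%:Z); rewrite {1}ey ey' PoszM mulrA.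
  have [|| r [rx ry]] := @pt_exists n (px a + X) (py a + Y).
  - by clear -eX hx1 hx2 g0; rewrite /x in eX; nia.
  - by clear -eY hy1 hy2 g0; rewrite /y in eY; nia.
  have gR : (g%:R : R) != 0 by rewrite pnatr_eq0 -lt0n.
  apply: (emp r); exists (g%:R^-1); split.
    by rewrite invr_gt0 ltr0n g0 invf_lt1 ?ltr0n // ltr1n; lia.
  apply: injective_projections; rewrite /= -/(px r) -/(py r) -/(px a) -/(px b) -/(py a) -/(py b).
    by rewrite -intrB -/x eX rx intrM intrD mulrCA mulVf ?mulr1.
  by rewrite -intrB -/y eY ry intrM intrD mulrCA mulVf ?mulr1.
have x0 : (0 < absz x)%N.
  rewrite lt0n; apply/negP => /eqP e; move: cop l2; rewrite e /coprime gcd0n /len.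
  by rewrite /x /y in e *; lia.
have y0 : (0 < absz y)%N.
  rewrite lt0n; apply/negP => /eqP e; move: cop l2; rewrite e /coprime gcdn0 /len.
  by rewrite /x /y in e *; lia.
have [u [v [ux vy e]]] := farey_mediant cop x0 y0.
have eZ : (absz x)%:Z * v%:Z = (absz y)%:Z * u%:Z + 1 by rewrite -!PoszM e.
have [||m [mx my]] := @pt_exists n (px a + e1 * u%:Z) (py a + e2 * v%:Z).
- by clear -ux ex hx1 hx2 sx; rewrite /x in ux ex sx *; case: sx ex => -> ex; lia.
- by clear -vy ey hy1 hy2 sy; rewrite /y in vy ey sy *; case: sy ey => -> ey; lia.
exists m.
  rewrite /det /dt -/x -/y mx my.
  have -> : x * (py a + e2 * v%:Z - py a) - y * (px a + e1 * u%:Z - px a) =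
     e1 * e2 * ((absz x)%:Z * v%:Z - (absz y)%:Z * u%:Z).
    by rewrite {1}ex {1}ey; ring.
  by rewrite eZ; case: sx => ->; case: sy => ->; lia.
have bx : px b = px a + x by rewrite /x; ring.
have by_ : py b = py a + y by rewrite /y; ring.
rewrite /middle /btw mx my bx by_; clear -sx sy ux vy ex ey.
by move: x y sx sy ux vy ex ey => x y [->|->] [->|->] *; lia.
Qed.

(* The l1 distance between the midpoints, doubled. *)
Definition offset a b c d : nat :=
  (absz (px c + px d - (px a + px b))%R + absz (py c + py d - (py a + py b))%R)%N.

Lemma offsetl a b c : offset a b a c = len b c.
Proof. by rewrite /offset /len; lia. Qed.

Lemma offsetr a b c : offset a b c b = len c a.
Proof. by rewrite /offset /len; lia. Qed.

(* Going from an edge to the longest side of an adjacent triangle moves twice the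
   midpoint by exactly the increase in length. *)
Lemma edge_below_flippable s a b : triangulation R s -> edge s a b -> (1 < len a b)%N ->
  exists p m m' q, [/\ tri s p m q, tri s p m' q, m != m' &
    (len a b + offset a b p q <= len p q)%N].
Proof.
move=> ts; have gs := proj1 ts.
have lb c d : (len c d <= 2 * side n)%N.
  have := px_bound c; have := px_bound d; have := py_bound c; have := py_bound d.
  by rewrite /len /side; lia.
have [k] := ubnP (2 * side n - len a b)%N.
elim: k a b => // k IH a b hk eab l2.
have rec c d : edge s c d -> (len a b < len c d)%N -> (len a b + offset a b c d <= len c d)%N ->
    exists p m m' q, [/\ tri s p m q, tri s p m' q, m != m' &
      (len a b + offset a b p q <= len p q)%N].
  move=> ecd l1 l3; have [||p [m [m' [q [t1 t2 mm' h]]]]] := IH c d _ ecd.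
  - by have := lb c d; lia.
  - by lia.
  - by exists p, m, m', q; split=> //; move: h l3; rewrite /offset; lia.
have [m dm mid] := edge_mediant gs eab l2.
have [m' pm] := par_exists mid; have [e _ _] := par_detE pm.
have [r [ear ebr er]] := apex_side ts eab dm.
have [|r' [ear' ebr' er']] := apex_side ts eab (m := m'); first by rewrite e normrN.
have up1 z : tri s a b z \/ tri s z a b -> exists p m m' q, [/\ tri s p m q, tri s p m' q, m != m' &
      (len a b + offset a b p q <= len p q)%N].
  case=> tz; have := tz; case/and5P=> e1 e2 e3 _ mz; have l := len_middle mz.
    have := len_gt0 (edge_neq gs e2) => l0.
    by apply: (rec a z) => //; rewrite ?offsetl l // -addn1 leq_add2l.
  have := len_gt0 (edge_neq gs e1) => l0.
  by apply: (rec z b) => //; rewrite ?offsetr l addnC // -[X in (X < _)%N]addn0 ltn_add2l.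
have [|t1|t1|t1] := apex_tri eab ear ebr; first by rewrite er.
- have [|t2|t2|t2] := apex_tri eab ear' ebr'; first by rewrite er' e normrN.
  + exists a, r, r', b; split=> //; last by rewrite /offset /len; lia.
    by apply/negP => /eqP rr; move: er' er; rewrite rr e; lia.
  + by apply: up1; left; exact: t2.
  + by apply: up1; right; exact: t2.
- by apply: up1; left; exact: t1.
- by apply: up1; right; exact: t1.
Qed.

(** A tie between the two sides of the parallelogram would make it a unit square, whose diagonal has
    length 2. *)
Lemma tri_flippable s p m m' q : triangulation R s -> tri s p m q -> tri s p m' q -> m != m' ->
  (2 < len p q)%N -> flippable s p m m' q \/ flippable s p m' m q.
Proof.
move=> ts t1 t2 mm' l3; have pr := tri_par ts t1 t2 mm'.
have pr' : par p m' m q by move: pr; rewrite /par [px m + _]addrC [py m + _]addrC.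
rewrite /flippable t1 t2 pr pr' /=; case: ltngtP => h; [by left | by right |].
exfalso; move: l3; have [_ _ _ /eqP hd mid] := and5P t1.
rewrite (len_middle mid).
have := @farey_balanced (px m - px p) (py m - py p) (px q - px m) (py q - py m).
have -> : (px m - px p) * (py q - py m) - (py m - py p) * (px q - px m) = det p m q.
  by rewrite /det /dt; ring.
move=> /(_ hd); case/andP: pr => /eqP hx /eqP hy.
by move: mid h; rewrite /middle /btw /len; lia.
Qed.

End Flips.

(** * Choice of the constants *)

Section Constants.

Variable R : archiRealFieldType.
Implicit Types b e x M : R.

Lemma expr_Bernoulli b (k : nat) : 1 <= b -> 1 + k%:R * (b - 1) <= b ^+ k.
Proof.
move=> b1; elim: k => [|k IH]; first by rewrite mul0r addr0 expr0.
rewrite exprSr; apply: le_trans (_ : (1 + k%:R * (b - 1)) * b <= _); last first.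
  by rewrite ler_wpM2r // (le_trans ler01).
have k0 : 0 <= k%:R :> R by [].
have h : 0 <= k%:R * ((b - 1) * (b - 1)) by rewrite mulr_ge0 // -expr2 sqr_ge0.
by rewrite -natr1; lra.
Qed.

Lemma expr_unbounded b M : 1 < b -> exists N : nat, forall k, (N <= k)%N -> M <= b ^+ k.
Proof.
move=> b1; have d0 : 0 < b - 1 by rewrite subr_gt0.
have [N hN] : exists N : nat, M / (b - 1) <= N%:R.
  by exists (Num.bound `|M / (b - 1)|); apply: le_trans (ler_norm _) (ltW (archi_boundP (normr_ge0 _))).
exists N => k Nk; apply: le_trans (expr_Bernoulli k (ltW b1)).
have : M / (b - 1) <= k%:R by apply: le_trans hN _; rewrite ler_nat.
by rewrite ler_pdivrMr //; lra.
Qed.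

Lemma expr_small e x : 0 < e < 1 -> 0 < x -> exists N : nat, forall k, (N <= k)%N -> e ^+ k <= x.
Proof.
move=> /andP[e0 e1] x0.
have [|N hN] := @expr_unbounded e^-1 x^-1; first by rewrite invf_gt1.
exists N => k /hN; rewrite exprVn lef_pV2 // posrE //; exact: exprn_gt0.
Qed.

(* The linear term absorbs the finitely many small triangles; for the large ones
   the exponential term alone is superadditive enough. *)
Lemma discharging_constants b e : 1 < b -> 0 < e < 1 ->
  exists th A : R, [/\ 0 < th < 1, 0 <= A &
    forall u v : nat, (0 < u)%N -> (0 < v)%N ->
    let f l := th * b ^+ l + A * (l%:R - 1) in
    [/\ f u + f v <= f (u + v)%N,
        f u + b ^+ (u + v) * e ^+ u <= f (u + v)%N &
        b ^+ (u + v) * e ^+ v + b ^+ (u + v) * e ^+ u <= f (u + v)%N]].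
Proof.
move=> b1 /andP[e0 e1].
(* Any value strictly between [e] and 1 would do: [th] must exceed [e] to pay for a leaf and stay
   below 1 to contract. *)
pose th := (1 + e) / 2; have th0 : 0 < th by rewrite /th; lra.
have th1 : th < 1 by rewrite /th; lra.
have eth : e < th by rewrite /th; lra.
have b0 : 0 < b by lra.
have bV1 : b^-1 < 1 by rewrite invf_lt1.
have e01 : 0 < e < 1 by rewrite e0.
(* [N1] serves the third inequality when one side is long; [N2] and [N3] serve the second one when
   [u], respectively [v], is large. *)
have [N1 h1] : exists N : nat, forall k, (N <= k)%N -> e ^+ k <= th - e.
  by apply: expr_small => //; lra.
have [N2 h2] : exists N : nat, forall k, (N <= k)%N -> e ^+ k <= th * (1 - b^-1).
  by apply: expr_small => //; apply: mulr_gt0 => //; lra.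
have [N3 h3] : exists N : nat, forall k, (N <= k)%N -> b^-1 ^+ k <= (th - e) / th.
  by apply: expr_small; [rewrite invr_gt0 b0 | apply: divr_gt0 => //; lra].
have [N [n1 n2 n3]] : exists N, [/\ (N1 <= N)%N, (N2 <= N)%N & (N3 <= N)%N].
  by exists (N1 + N2 + N3)%N; split; lia.
(* When [u] and [v] are below [N], each of the two terms on the left is at most b^(2N), while the
   linear part grows by at least [A]. *)
pose A := 2 * b ^+ (2 * N).
have A1 : 1 <= b ^+ (2 * N) by apply: exprn_ege1; apply: ltW.
exists th, A; split; first by rewrite th0.
  by rewrite /A; lra.
move=> u v u0 v0 f.
have u1 : 1 <= u%:R :> R by rewrite ler1n.
have v1 : 1 <= v%:R :> R by rewrite ler1n.
have pu : 1 <= b ^+ u by apply: exprn_ege1; apply: ltW.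
have pv : 1 <= b ^+ v by apply: exprn_ege1; apply: ltW.
have ele k : (0 < k)%N -> 0 <= e ^+ k <= e.
  by case: k => // k _; rewrite exprn_ge0 ?(ltW e0) //= exprS ler_piMr ?(ltW e0) // exprn_ile1 ?(ltW e0) ?(ltW e1).
have /andP[eu0 eue] := ele _ u0; have /andP[ev0 eve] := ele _ v0.
have small (x y : nat) : (x < N)%N -> (y < N)%N -> 0 <= A - 2 * b ^+ (x + y).
  move=> xN yN; rewrite subr_ge0 /A; apply: ler_wpM2l; first by [].
  by rewrite ler_eXn2l // mul2n -addnn leq_add // ltnW.
have bp : 0 < b ^+ (u + v) by apply: exprn_gt0.
have AV : 0 <= A * (v%:R - 1) by apply: mulr_ge0; [rewrite /A; lra | lra].
have AU : 0 <= A * (u%:R - 1) by apply: mulr_ge0; [rewrite /A; lra | lra].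
have A0 : 2 <= A by rewrite /A; lra.
rewrite /f natrD; split.
- have h : 0 <= (b ^+ u - 1) * (b ^+ v - 1) by apply: mulr_ge0; lra.
  have : 0 <= th * ((b ^+ u - 1) * (b ^+ v - 1)) by apply: mulr_ge0; lra.
  by rewrite exprD; lra.
- suff : th * b ^+ u + b ^+ (u + v) * e ^+ u <= th * b ^+ (u + v) + A by lra.
  have bu : b ^+ u = b ^+ (u + v) * b^-1 ^+ v by rewrite exprD exprVn mulfK // expf_neq0 // gt_eqF.
  have [Nu|uN] := leqP N u.
    have hh : e ^+ u <= th * (1 - b^-1) by apply: h2; exact: leq_trans Nu.
    have bv : b^-1 ^+ v <= b^-1.
      by case: v v0 {v1 pv ev0 eve bp AV bu} => // v _; rewrite exprS ler_piMr ?invr_ge0 ?(ltW b0) // exprn_ile1 ?invr_ge0 ?(ltW b0) ?(ltW bV1).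
    suff : b ^+ (u + v) * (th * b^-1 ^+ v + e ^+ u) <= b ^+ (u + v) * th by rewrite bu; lra.
    rewrite ler_pM2l //.
    have : th * b^-1 ^+ v <= th * b^-1 by rewrite ler_pM2l.
    by lra.
  have [Nv|vN] := leqP N v.
    have hh : b^-1 ^+ v <= (th - e) / th by apply: h3; exact: leq_trans Nv.
    have : th * b^-1 ^+ v <= th - e by rewrite mulrC -ler_pdivlMr.
    move=> hv; suff : b ^+ (u + v) * (th * b^-1 ^+ v + e ^+ u) <= b ^+ (u + v) * th by rewrite bu; lra.
    by rewrite ler_pM2l //; lra.
  have := small _ _ uN vN.
  have s1 : th * b ^+ u <= b ^+ (u + v).
    rewrite exprD mulrC ler_pM2l ?exprn_gt0 //; lra.
  have s2 : b ^+ (u + v) * e ^+ u <= b ^+ (u + v) by rewrite ler_piMr ?(ltW bp) //; lra.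
  have s3 : 0 < th * b ^+ (u + v) by apply: mulr_gt0.
  by lra.
- suff : b ^+ (u + v) * e ^+ v + b ^+ (u + v) * e ^+ u <= th * b ^+ (u + v) + A by lra.
  have big (x y : nat) : (N <= x)%N -> e ^+ y <= e -> e ^+ y + e ^+ x <= th.
    move=> Nx hy; have : e ^+ x <= th - e by apply: h1; exact: leq_trans Nx.
    by lra.
  rewrite -mulrDr.
  have [Nu|uN] := leqP N u.
    have h := big _ _ Nu eve.
    have : b ^+ (u + v) * (e ^+ v + e ^+ u) <= b ^+ (u + v) * th by rewrite ler_pM2l.
    by lra.
  have [Nv|vN] := leqP N v.
    have h := big _ _ Nv eue.
    have : b ^+ (u + v) * (e ^+ v + e ^+ u) <= b ^+ (u + v) * th by rewrite ler_pM2l // addrC.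
    by lra.
  have := small _ _ uN vN.
  have s2 : b ^+ (u + v) * (e ^+ v + e ^+ u) <= b ^+ (u + v) * 2 by rewrite ler_pM2l //; lra.
  have s3 : 0 < th * b ^+ (u + v) by apply: mulr_gt0.
  by lra.
Qed.

(** Used to trade the linear part of the potential for an arbitrarily small multiple of the charge
    plus a constant per edge. *)
Lemma linear_expr_bound b A d : 1 < b -> 0 <= A -> 0 < d ->
  exists2 B, 0 <= B & forall l : nat, A * (l%:R - 1) * b ^+ l <= d * b ^+ (3 * l) + B.
Proof.
move=> b1 A0 d0.
have [N hN] := expr_unbounded (A / (d * (b - 1))) b1.
have db : 0 < d * (b - 1) by apply: mulr_gt0; lra.
have bn k : 0 < b ^+ k by apply: exprn_gt0; lra.
exists (A * N%:R * b ^+ N) => [|l]; first by rewrite !mulr_ge0 // ltW.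
have [Nl|lN] := leqP N l.
  have h1 := hN _ Nl; rewrite ler_pdivrMr // in h1.
  have h2 := expr_Bernoulli l (ltW b1).
  have h3 : A * (l%:R - 1) <= d * b ^+ (2 * l).
    rewrite mul2n -addnn exprD.
    apply: le_trans (_ : A * l%:R <= _); first by rewrite ler_wpM2l //; lra.
    apply: le_trans (_ : b ^+ l * (d * (b - 1)) * l%:R <= _); first by rewrite ler_wpM2r.
    have -> : b ^+ l * (d * (b - 1)) * l%:R = d * b ^+ l * ((b - 1) * l%:R) by ring.
    by rewrite [d * (_ * _)]mulrA ler_pM2l ?mulr_gt0 //; lra.
  have h4 : A * (l%:R - 1) * b ^+ l <= d * b ^+ (2 * l) * b ^+ l by rewrite ler_wpM2r // ltW.
  have h5 : 0 <= A * N%:R * b ^+ N by rewrite !mulr_ge0 // ltW.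
  have h6 : b ^+ (2 * l) * b ^+ l = b ^+ (3 * l) by rewrite -exprD -mulSnr.
  by rewrite -[d * _ * _]mulrA h6 in h4; lra.
have h : A * (l%:R - 1) * b ^+ l <= A * N%:R * b ^+ N.
  apply: le_trans (_ : A * l%:R * b ^+ l <= _).
    by rewrite ler_wpM2r ?(ltW (bn l)) // ler_wpM2l //; lra.
  apply: ler_pM; [exact: mulr_ge0 | exact: ltW | |].
    by rewrite ler_wpM2l // ler_nat ltnW.
  by rewrite ler_eXn2l // ltnW.
have : 0 < d * b ^+ (3 * l) by apply: mulr_gt0.
by lra.
Qed.

Lemma ratio_exists x : 0 < x < 1 -> exists2 g, 1 < g & x ^+ 2 * g ^+ 4 < 1.
Proof.
move=> /andP[x0 x1]; pose t := (1 - x) / 4.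
have t1 : 0 < t < 1 by rewrite /t; lra.
have hx : x < (1 - t) ^+ 2 by rewrite expr2 /t; nra.
have r0 : 0 < 1 - t by lra.
exists ((1 - t)^-1); first by rewrite invf_gt1 //; lra.
rewrite exprVn ltr_pdivrMr ?exprn_gt0 // mul1r.
rewrite -[4%N]/(2 * 2)%N exprM ltrXn2r //; exact: ltW.
Qed.

End Constants.

(** With truncated subtraction the exponent is |i - c|. The induction carries the telescoped bound,
    whose form changes when [K] passes [c]. *)
Lemma geometric_two_sided (R : realFieldType) (x : R) (K c : nat) : 0 < x < 1 ->
  \sum_(i < K) x ^+ ((i - c) + (c - i))%N <= 2 / (1 - x).
Proof.
move=> /andP[x0 x1]; rewrite ler_pdivlMr; last by lra.
have p k : 0 <= x ^+ k by apply: exprn_ge0; lra.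
suff : (\sum_(i < K) x ^+ ((i - c) + (c - i))%N) * (1 - x) <=
    if (K <= c)%N then x ^+ (c - K).+1 else 2 - x ^+ (K - c).
  move/le_trans; apply; case: ifP => _.
    have : x ^+ (c - K).+1 <= 1 by rewrite exprn_ile1 ?(ltW x0) ?(ltW x1).
    by lra.
  by have := p (K - c)%N; lra.
elim: K => [|K IH]; first by rewrite big_ord0 mul0r leq0n.
rewrite big_ord_recr /= mulrDl.
have [Kc|cK] := ltnP K c.
  have e : (c - K)%N = (c - K.+1).+1 by rewrite subnSK.
  rewrite (ltnW Kc) in IH; have -> : (K - c)%N = 0%N by apply/eqP; rewrite subn_eq0 ltnW.
  rewrite e in IH *; rewrite add0n; move: IH; rewrite [x ^+ _.+2]exprS; lra.
have -> : (c - K)%N = 0%N by apply/eqP; rewrite subn_eq0.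
rewrite addn0 subSn // exprS; move: IH; case: ifP => [Kc|_]; last by lra.
have -> : K = c by apply/eqP; rewrite eqn_leq Kc cK.
by rewrite subnn expr0 expr1; lra.
Qed.

Lemma sum_le_of_inj (R : realFieldType) (I J : finType) (P : pred I) (Q : pred J) (h : I -> J)
    (F : I -> R) (G : J -> R) :
  {in P &, injective h} -> (forall i, P i -> Q (h i) /\ F i <= G (h i)) ->
  (forall j, Q j -> 0 <= G j) ->
  \sum_(i | P i) F i <= \sum_(j | Q j) G j.
Proof.
move=> inj hP G0.
apply: le_trans (_ : \sum_(i | P i) G (h i) <= _).
  by apply: ler_sum => i /hP[].
have -> : \sum_(i | P i) G (h i) = \sum_(i in [set i | P i]) G (h i).
  by apply: eq_bigl => i; rewrite inE.
rewrite -(big_imset G) /=; last by move=> x y; rewrite !inE; exact: inj.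
rewrite [X in _ <= X](bigID [pred j | j \in h @: [set i | P i]]) /= ler_wpDr //.
  by apply: sumr_ge0 => j /andP[/G0].
rewrite le_eqVlt; apply/orP; left; apply/eqP; apply: eq_bigl => j.
apply/idP/idP => [hj|/andP[]//]; rewrite hj andbT.
by have /imsetP[i] := hj; rewrite inE => /hP[Qi _] ->.
Qed.

(** * Discharging along triangles *)

Section Discharging.

Variables (R : realFieldType) (n : nat) (g lam th A : R).
Variable s : {set seg n}.
Implicit Types (p q r a b c d m : pt n).

Hypotheses (g1 : 1 < g) (lam0 : 0 < lam) (th0 : 0 < th) (A0 : 0 <= A).

(** Twice the l1 norm of the midpoint. *)
Definition mid a b : nat := (absz (px a + px b)%R + absz (py a + py b)%R)%N.
(* Damping at the midpoint of [ab]; multiplied by [g ^+ len a b] it increases from a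
   side of a triangle to its longest side. *)
Definition wt a b : R := g ^- mid a b.
Definition wlen a b : R := wt a b * g ^+ len a b.
(* [pot] is the charge (per unit of [wlen]) of an edge that is longest in some
   triangle; [leaf e v] is the cost of a short diagonal whose adjacent triangles have
   longest side of length [e] and third side of length [v].  Edges are counted with
   both orientations throughout. *)
Definition pot (l : nat) : R := th * (g ^+ 2) ^+ l + A * (l%:R - 1).
Definition leaf (e v : nat) : R := (g ^+ 2) ^+ e * (lam ^+ 2 * g ^+ 4) ^+ v.

(** These are the three inequalities of [discharging_constants] for b = g^2 and e = lam^2 g^4. They
    cover a triangle according to how many of its two shorter sides are longest in a further
    triangle. *)
Hypothesis pot_pot : forall u v, (0 < u)%N -> (0 < v)%N -> pot u + pot v <= pot (u + v).
Hypothesis pot_leaf : forall u v, (0 < u)%N -> (0 < v)%N -> pot u + leaf (u + v) u <= pot (u + v).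
Hypothesis leaf_leaf : forall u v, (0 < u)%N -> (0 < v)%N ->
  leaf (u + v) v + leaf (u + v) u <= pot (u + v).

Lemma g_gt0 : 0 < g. Proof. exact: lt_trans g1. Qed.

Lemma wt_gt0 a b : 0 < wt a b. Proof. by rewrite invr_gt0 exprn_gt0 ?g_gt0. Qed.

Lemma wlen_gt0 a b : 0 < wlen a b.
Proof. by rewrite mulr_gt0 ?wt_gt0 // exprn_gt0 ?g_gt0. Qed.

Lemma pot_ge0 l : (0 < l)%N -> 0 <= pot l.
Proof.
move=> l0; rewrite addr_ge0 // mulr_ge0 ?(ltW th0) ?exprn_ge0 ?(ltW g_gt0) //.
by rewrite subr_ge0 ler1n.
Qed.

Lemma leaf_gt0 e v : 0 < leaf e v.
Proof. by have g0 := g_gt0; rewrite /leaf !(mulr_gt0, exprn_gt0). Qed.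

Lemma wt_le a b c d k : (mid c d <= mid a b + k)%N -> wt a b <= wt c d * g ^+ k.
Proof.
move=> h; rewrite /wt -[leLHS]mul1r ler_pdivrMr ?exprn_gt0 ?g_gt0 //.
rewrite mulrAC -mulrA -exprD mulrC ler_pdivlMr ?exprn_gt0 ?g_gt0 // mul1r.
by rewrite ler_eXn2l // addnC.
Qed.

Lemma mid_sym a b : mid a b = mid b a.
Proof. by rewrite /mid; lia. Qed.

Lemma wlen_sym a b : wlen a b = wlen b a.
Proof. by rewrite /wlen /wt mid_sym len_sym. Qed.

Lemma wlen_first p m q : middle p m q -> wlen p m <= wlen p q.
Proof.
move=> mq; rewrite /wlen (len_middle mq) addnC exprD mulrA.
apply: ler_wpM2r; first by rewrite exprn_ge0 ?(ltW g_gt0).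
by apply: wt_le; rewrite /mid /len; lia.
Qed.

Lemma wlen_second p m q : middle p m q -> wlen m q <= wlen p q.
Proof. by rewrite middle_sym wlen_sym [wlen p q]wlen_sym; exact: wlen_first. Qed.

Definition hasdown a b : bool := [exists m, tri s a m b].

(** What a triangle pays to a shorter side: its potential if that side has to pay further triangles,
    and otherwise the cost it may incur as a short diagonal. *)
Definition share (down : bool) (l e v : nat) : R := if down then pot l else leaf e v.

Hypothesis ts : triangulation R s.

Lemma tri_neq p m q : tri s p m q -> [/\ p != m, m != q & p != q].
Proof.
have gs := proj1 ts.
by case/and5P=> /(edge_neq gs) h1 /(edge_neq gs) h2 /(edge_neq gs) h3 _ _.
Qed.

Lemma share_ge0 (down : bool) l e v : (0 < l)%N -> 0 <= share (down : bool) l e v.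
Proof. by case: down => h /=; [exact: pot_ge0 | exact/ltW/leaf_gt0]. Qed.

Lemma share_le p m q : tri s p m q ->
  wlen p m * share (hasdown p m) (len p m) (len p q) (len m q) +
  wlen m q * share (hasdown m q) (len m q) (len p q) (len p m) <= wlen p q * pot (len p q).
Proof.
move=> t; have [n1 n2 _] := tri_neq t; have [_ _ _ _ mpq] := and5P t.
have l1 := len_gt0 n1; have l2 := len_gt0 n2.
apply: le_trans (_ : wlen p q * (share (hasdown p m) (len p m) (len p q) (len m q) +
   share (hasdown m q) (len m q) (len p q) (len p m)) <= _).
  rewrite mulrDr lerD // ler_wpM2r ?share_ge0 //; [exact: wlen_first | exact: wlen_second].
rewrite ler_pM2l ?wlen_gt0 // (len_middle mpq) /share.
case: (hasdown p m); case: (hasdown m q) => /=.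
- exact: pot_pot.
- exact: pot_leaf.
- by rewrite addrC addnC; exact: pot_leaf.
- exact: leaf_leaf.
Qed.

(** The two sides of [ab] are already occupied by triangles in which [ab] is a shorter side; by
    [apex_unique] there is no other triangle. *)
Lemma up_no_down p a b q : up s p b a q -> ~~ hasdown a b.
Proof.
case/and3P=> t1 t2 pr; apply/negP => /existsP[m t].
have [_ hd _] := par_detE pr.
have [e1 e2 e3 /eqP h1 m1] := and5P t1; have [e4 e5 e6 /eqP h2 m2] := and5P t2.
have h := tri_det t; have [e7 e8 e9 _ m3] := and5P t.
have [n1 n2 n3] := tri_neq t1; have [n4 n5 n6] := tri_neq t2.
have d1 : det a b p = det p a b by rewrite det_rot.
have d2 : det a b q = - det a b p.
  have [ex ey] := par_coords pr; by rewrite /det /dt ex ey; ring.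
have h1' : `|det a b p| = 1 by rewrite d1.
have l1 := len_gt0 n1; have l4 := len_gt0 n4; have l2 := len_gt0 n2; have l5 := len_gt0 n5.
have [e|e] : det a b p = det a b m \/ det a b q = det a b m by clear -h h1' d2; lia.
  have em : p = m by apply: (apex_unique (proj1 ts) e2 _ _ e7 _ h1' e) => //; rewrite edge_sym.
  subst m; have := len_middle m1; have := len_middle m3.
  by rewrite (len_sym a p); clear -l1 l2; lia.
have em : q = m.
  by apply: (apex_unique (proj1 ts) e2 e6 _ e7 _ _ e); rewrite ?[edge s b m]edge_sym // d2 normrN.
subst m; have := len_middle m2; have := len_middle m3.
by rewrite (len_sym q b); clear -l4 l5; lia.
Qed.

Lemma down_count a b : (#|[pred m | tri s a m b]| <= 2)%N.
Proof.
rewrite -card_bool; apply: (@leq_trans #|[set (det a b m == 1) | m in [pred m | tri s a m b]]|).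
  rewrite card_in_imset // => m m'; rewrite !inE => t t' e.
  have h := tri_det t; have h' := tri_det t'.
  apply: (tri_eq_side ts t t'); move: e; clear -h h'.
  by case: eqP => [->|?]; case: eqP => // *; lia.
exact: max_card.
Qed.

Definition bidown a b : bool := [exists m, exists m', [&& tri s a m b, tri s a m' b & m != m']].

Lemma down_count1 a b : ~~ bidown a b -> (#|[pred m | tri s a m b]| <= 1)%N.
Proof.
move=> h; apply/card_le1P => m; rewrite inE => t m'; rewrite !inE.
apply/idP/eqP => [t'|->//]; apply/eqP; apply: contraR h => ne.
by apply/existsP; exists m'; apply/existsP; exists m; rewrite t t'.
Qed.

Lemma sum_tri_const a b (x : R) : \sum_m (tri s a m b)%:R * x = #|[pred m | tri s a m b]|%:R * x.
Proof.
rewrite -mulr_suml; congr (_ * _); rewrite -sum1_card natr_sum [RHS]big_mkcond /=.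
by apply: eq_bigr => m _; rewrite inE; case: ifP.
Qed.

(** Along the path from one end of a longest side to the other through the middle vertex, [ab] may
    be the first or the second step; the two sums collect the charges received in these
    positions. *)
Definition first_share a b : R :=
  \sum_c (tri s a b c)%:R * (wlen a b * share (hasdown a b) (len a b) (len a c) (len b c)).
Definition second_share a b : R :=
  \sum_c (tri s c a b)%:R * (wlen a b * share (hasdown a b) (len a b) (len c b) (len c a)).
Definition up_cost a b : R :=
  \sum_p \sum_q (up s p b a q)%:R * (wlen a b * leaf (len p b) (len p a)).

Lemma share_term_ge0 a b c e v (t : bool) : (t -> tri s a b c \/ tri s c a b) ->
  0 <= t%:R * (wlen a b * share (hasdown a b) (len a b) e v).
Proof.
case: t => [|_]; last by rewrite mul0r.
move=> /(_ isT) h; rewrite mul1r mulr_ge0 ?(ltW (wlen_gt0 _ _)) // share_ge0 // len_gt0 //.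
by case: h => /tri_neq[].
Qed.

Lemma first_share_ge0 a b : 0 <= first_share a b.
Proof. by apply: sumr_ge0 => c _; apply: (@share_term_ge0 _ _ c); left. Qed.

Lemma second_share_ge0 a b : 0 <= second_share a b.
Proof. by apply: sumr_ge0 => c _; apply: (@share_term_ge0 _ _ c); right. Qed.

Lemma par_inj p p' q q' a b : par p b a q -> par p' b a q' -> p = p' \/ q = q' -> p = p' /\ q = q'.
Proof.
move=> /andP[/eqP x1 /eqP y1] /andP[/eqP x2 /eqP y2] [e|e]; subst; split=> //; apply: pt_ext; lia.
Qed.

Lemma par_len p a b q : par p b a q -> len a q = len p b /\ len b q = len p a.
Proof. by case/andP=> /eqP h1 /eqP h2; rewrite /len; lia. Qed.

(** The parallelogram determines [p] from [q] and has equal opposite sides, so the cost of the short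
    diagonal is exactly the share paid by the triangle a, b, q. *)
Lemma up_cost_first a b : ~~ hasdown a b -> up_cost a b <= first_share a b.
Proof.
move=> nd; rewrite /up_cost exchange_big; apply: ler_sum => q _.
rewrite (negbTE nd) /=.
have [/existsP[p0 h0]|no] := boolP [exists p, up s p b a q]; last first.
  rewrite big1 => [|p _]; first by rewrite mulr_ge0 // mulr_ge0 ?(ltW (wlen_gt0 _ _)) // (ltW (leaf_gt0 _ _)).
  by case: (boolP (up s p b a q)) => [h|_]; [case/existsP: no; exists p | rewrite mul0r].
rewrite (bigD1 p0) //= big1 ?addr0 => [|p pp0].
  have [t1 t2 pr] := and3P h0; rewrite h0 t2.
  by have [-> ->] := par_len pr.
case: (boolP (up s p b a q)) => [h|_]; last by rewrite mul0r.
have [_ _ pr] := and3P h; have [_ _ pr0] := and3P h0.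
by have [e _] := par_inj pr pr0 (or_intror erefl); rewrite e eqxx in pp0.
Qed.

Lemma up_cost_second a b : ~~ hasdown a b -> up_cost a b <= second_share a b.
Proof.
move=> nd; apply: ler_sum => p _; rewrite (negbTE nd) /=.
have [/existsP[q0 h0]|no] := boolP [exists q, up s p b a q]; last first.
  rewrite big1 => [|q _]; first by rewrite mulr_ge0 // mulr_ge0 ?(ltW (wlen_gt0 _ _)) // (ltW (leaf_gt0 _ _)).
  by case: (boolP (up s p b a q)) => [h|_]; [case/existsP: no; exists q | rewrite mul0r].
rewrite (bigD1 q0) //= big1 ?addr0 => [|q qq0].
  by have [t1 t2 pr] := and3P h0; rewrite h0 t1.
case: (boolP (up s p b a q)) => [h|_]; last by rewrite mul0r.
have [_ _ pr] := and3P h; have [_ _ pr0] := and3P h0.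
by have [_ e] := par_inj pr pr0 (or_introl erefl); rewrite e eqxx in qq0.
Qed.

(** A short diagonal is paid by each of its two triangles, hence its cost counts twice. An edge
    longest in exactly one triangle passes on the potential received from the other. An edge longest
    in both is paid by no triangle, and its potential, needed at most twice, is the external
    supply. *)
Lemma edge_balance a b :
  \sum_m (tri s a m b)%:R * (wlen a b * pot (len a b)) + up_cost a b *+ 2 <=
  first_share a b + second_share a b + (bidown a b)%:R * (wlen a b * pot (len a b)) *+ 2.
Proof.
have [hd|nd] := boolP (hasdown a b); last first.
  rewrite big1 => [|m _]; last first.
    by case: (boolP (tri s a m b)) => h; [case/negP: nd; apply/existsP; exists m | rewrite mul0r].
  have -> : bidown a b = false.
    apply/negbTE/negP => /existsP[m /existsP[m' /and3P[h _ _]]]; by case/negP: nd; apply/existsP; exists m.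
  by rewrite mul0r mul0rn addr0 add0r mulr2n lerD ?up_cost_first ?up_cost_second.
have -> : up_cost a b = 0.
  apply: big1 => p _; apply: big1 => q _.
  by case: (boolP (up s p b a q)) => [/up_no_down|_]; [rewrite hd | rewrite mul0r].
rewrite mul0rn addr0 sum_tri_const.
have /existsP[m t] := hd; have [_ _ ab] := tri_neq t.
have x0 : 0 <= wlen a b * pot (len a b).
  by rewrite mulr_ge0 ?(ltW (wlen_gt0 _ _)) // pot_ge0 // len_gt0.
set x := wlen a b * _ in x0 *.
have F0 := first_share_ge0 a b; have S0 := second_share_ge0 a b.
have [bd|nb] := boolP (bidown a b).
  rewrite mul1r; apply: le_trans (_ : x *+ 2 <= _); last by rewrite lerDr addr_ge0.
  by rewrite -[x *+ 2]mulr_natl ler_wpM2r // ler_nat down_count.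
rewrite mul0r mul0rn addr0.
apply: le_trans (_ : x <= _).
  by rewrite -[leRHS]mul1r ler_wpM2r // lern1 down_count1.
have one (F : pt n -> bool) (G : pt n -> R) c : F c -> (forall c, 0 <= (F c)%:R * G c) ->
    G c <= \sum_c (F c)%:R * G c.
  move=> Fc h; rewrite (bigD1 c) //= Fc mul1r lerDl; apply: sumr_ge0 => d _; exact: h.
have [[r t' rm]|[r t']|[r t']] := tri_next ts t.
- by case/negP: nb; apply/existsP; exists r; apply/existsP; exists m; rewrite t t' rm.
- apply: le_trans (_ : first_share a b <= _); last by rewrite lerDl.
  apply: le_trans (one (tri s a b) (fun c => wlen a b * share (hasdown a b) (len a b) (len a c) (len b c)) r t' _).
    by rewrite hd.
  by move=> c; apply: (@share_term_ge0 _ _ c); left.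
- apply: le_trans (_ : second_share a b <= _); last by rewrite lerDr.
  apply: le_trans (one (fun c => tri s c a b) (fun c => wlen a b * share (hasdown a b) (len a b) (len c b) (len c a)) r t' _).
    by rewrite hd.
  by move=> c; apply: (@share_term_ge0 _ _ c); right.
Qed.

(** Summed over oriented edges, the charges sent and received are sums over the same triangles and
    cancel by [share_le]; the two remaining terms of [edge_balance] share the factor 2. *)
Lemma up_cost_le : \sum_a \sum_b up_cost a b <=
  \sum_a \sum_b (bidown a b)%:R * (wlen a b * pot (len a b)).
Proof.
have sp (F G : pt n -> pt n -> R) :
    \sum_a \sum_b (F a b + G a b) = \sum_a \sum_b F a b + \sum_a \sum_b G a b.
  by under eq_bigr do rewrite big_split /=; rewrite big_split.
pose D a b := \sum_m (tri s a m b)%:R * (wlen a b * pot (len a b)).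
pose Y a b := (bidown a b)%:R * (wlen a b * pot (len a b)).
have h1 : \sum_a \sum_b (D a b + (up_cost a b + up_cost a b)) <=
    \sum_a \sum_b (first_share a b + second_share a b + (Y a b + Y a b)).
  by apply: ler_sum => a _; apply: ler_sum => b _; rewrite -!mulr2n; exact: edge_balance.
have h2 : \sum_a \sum_b (first_share a b + second_share a b) <= \sum_a \sum_b D a b.
  have -> : \sum_a \sum_b (first_share a b + second_share a b) =
      \sum_p \sum_m \sum_q (tri s p m q)%:R *
        (wlen p m * share (hasdown p m) (len p m) (len p q) (len m q) +
         wlen m q * share (hasdown m q) (len m q) (len p q) (len p m)).
    have -> : \sum_a \sum_b (first_share a b + second_share a b) =
        \sum_a \sum_b first_share a b + \sum_c \sum_a \sum_b (tri s c a b)%:R *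
        (wlen a b * share (hasdown a b) (len a b) (len c b) (len c a)).
      rewrite sp; congr (_ + _); rewrite [RHS]exchange_big; apply: eq_bigr => a _.
      by rewrite [RHS]exchange_big.
    rewrite -sp; apply: eq_bigr => p _; apply: eq_bigr => m _.
    by rewrite -big_split; apply: eq_bigr => q _; rewrite mulrDr.
  apply: ler_sum => p _; rewrite exchange_big; apply: ler_sum => q _; apply: ler_sum => m _.
  by case: (boolP (tri s p m q)) => [t|_]; [rewrite !mul1r; exact: share_le | rewrite !mul0r].
move: h1 h2; rewrite !sp -/(Y _ _).
move: (\sum_a \sum_b D a b) (\sum_a \sum_b first_share a b) (\sum_a \sum_b second_share a b).
by move: (\sum_a \sum_b up_cost a b) (\sum_a \sum_b Y a b) => *; lra.
Qed.

End Discharging.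

Lemma asbP (P : Prop) : asb P <-> P.
Proof. by rewrite /asb; case: ClassicalDescription.excluded_middle_informative. Qed.

Lemma OmegaP (R : realFieldType) n (s : {set seg n}) : reflect (triangulation R s) (s \in Omega R n).
Proof. by apply: (iffP idP); rewrite inE => /asbP. Qed.

Lemma Omega_nonempty (R : realFieldType) n : exists s, s \in Omega R n.
Proof.
pose P (s : {set seg n}) := asb (good_family R s).
have P0 : P set0 by apply/asbP; split=> [e|e f]; rewrite inE.
have [s /maxsetP[/asbP gs mx] _] := maxset_exists P0.
exists s; apply/OmegaP; split=> // t gt st; apply: mx => //; exact/asbP.
Qed.

(** * Expectations under the Gibbs measure *)

Section Weights.

Variables (R : realFieldType) (n : nat) (g lam : R).
Hypotheses (g1 : 1 < g) (lam0 : 0 < lam).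
Implicit Types (p q a b c d m : pt n) (s : {set seg n}).

Local Notation quad := ((pt n * pt n) * (pt n * pt n))%type.

(* A quadruple [((m', m), (p, q))] stands for the parallelogram with diagonals [pq]
   and [mm']. *)
Definition flippable_at s (x : quad) : bool := flippable s x.2.1 x.1.2 x.1.1 x.2.2.
Definition up_at s (x : quad) : bool := up s x.2.1 x.1.2 x.1.1 x.2.2.
Definition flip_gain (x : quad) : nat := (2 * len x.2.1 x.1.1)%N.
Definition charge (x : quad) : R := wt g x.2.1 x.2.2 * g ^+ (3 * len x.2.1 x.2.2).

Definition flippable_sum s : R := \sum_x (flippable_at s x)%:R * charge x.
Definition up_sum s : R := \sum_x (up_at s x)%:R * (lam ^+ flip_gain x * charge x).
Definition edge_sum s : R := \sum_a \sum_b (edge s a b)%:R * wt g a b.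

Let g0 : 0 < g. Proof. exact: lt_trans g1. Qed.

Lemma charge_gt0 x : 0 < charge x.
Proof. by rewrite mulr_gt0 ?wt_gt0 // exprn_gt0. Qed.

Lemma wt_mid_eq a b c d : mid a b = mid c d -> wt g a b = wt g c d.
Proof. by rewrite /wt => ->. Qed.

(** With v = |pa| and u = |ab| one has |pb| = u + v and |pq| = u + 2v; splitting 3(u + 2v) as u +
    2(u + v) + 4v separates [wlen] from the two factors of [leaf]. *)
Lemma up_charge s p b a q : up s p b a q ->
  wlen g a b * leaf g lam (len p b) (len p a) = lam ^+ (2 * len p a) * (wt g p q * g ^+ (3 * len p q)).
Proof.
case/and3P => /and5P[_ _ _ _ m1] /and5P[_ _ _ _ m2] pr.
have e1 := len_middle m1; have [ex ey] := par_coords pr.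
have e2 : len p q = (len p b + len p a)%N.
  by move: m1 m2; rewrite /middle /btw /len ex ey; clear; lia.
have -> : wt g p q = wt g a b.
  by apply: wt_mid_eq; rewrite /mid ex ey; clear; lia.
rewrite /wlen /leaf e2 e1; move: (len p a) (len a b) (wt g a b) => v u w.
rewrite [(lam ^+ 2 * _) ^+ v]exprMn -!exprM.
have -> : (3 * (v + u + v) = u + (2 * (v + u) + 4 * v))%N by clear; lia.
by rewrite !exprD; ring.
Qed.

Lemma up_sumE s : up_sum s = \sum_a \sum_b up_cost g lam s a b.
Proof.
rewrite /up_sum /up_cost -(pair_bigA _ (fun ab pq => (up_at s (ab, pq))%:R *
  (lam ^+ flip_gain (ab, pq) * charge (ab, pq)))) /=.
rewrite [RHS]pair_bigA; apply: eq_bigr => -[a b] _ /=; rewrite [RHS]pair_bigA; apply: eq_bigr => -[p q] _ /=.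
rewrite /up_at /flip_gain /charge /=; case: (boolP (up s p b a q)) => h; last by rewrite !mul0r.
by rewrite (up_charge h).
Qed.

Lemma flippable_sumE s : flippable_sum s = \sum_p \sum_q \sum_m \sum_m'
  (flippable s p m' m q)%:R * (wt g p q * g ^+ (3 * len p q)).
Proof.
rewrite /flippable_sum -(pair_bigA _ (fun ab pq => (flippable_at s (ab, pq))%:R * charge (ab, pq))) /=.
rewrite exchange_big [RHS]pair_bigA; apply: eq_bigr => -[p q] _ /=.
by rewrite [RHS]pair_bigA; apply: eq_bigr => -[a b] _.
Qed.

(** An edge longest in both triangles is a flippable long diagonal unless it has length 2; in that
    case g^(3 * 2) is charged to the edge count. *)
Lemma bidown_charge s th0 th A B a b : triangulation R s -> 0 <= th -> 0 <= B ->
  (forall l, g ^+ l * pot g th0 A l <= th * g ^+ (3 * l) + B) ->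
  (bidown s a b)%:R * (wlen g a b * pot g th0 A (len a b)) <=
  th * (\sum_m \sum_m' (flippable s a m' m b)%:R * (wt g a b * g ^+ (3 * len a b))) +
  (th * g ^+ 6 + B) * ((edge s a b)%:R * wt g a b).
Proof.
move=> ts th_ge0 B0 hB; have w0 := wt_gt0 g1 a b.
set S := \sum_m _; have S0 : 0 <= S.
  by do 2 apply: sumr_ge0 => ? _; rewrite mulr_ge0 // mulr_ge0 ?(ltW w0) // exprn_ge0 // ltW.
have T0 : 0 <= th * g ^+ 6 by rewrite mulr_ge0 // exprn_ge0 // ltW.
have [|_] := boolP (bidown s a b); last first.
  by rewrite mul0r addr_ge0 // mulr_ge0 ?addr_ge0 // mulr_ge0 // ltW.
case/existsP=> m /existsP[m' /and3P[t1 t2 mm']].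
have [_ _ e _ mid1] := and5P t1; have [n1 n2 _] := tri_neq ts t1.
have l2 : (1 < len a b)%N.
  by rewrite (len_middle mid1); have := len_gt0 n1; have := len_gt0 n2; clear; lia.
rewrite e !mul1r.
apply: le_trans (_ : wt g a b * (th * g ^+ (3 * len a b) + B) <= _).
  by rewrite /wlen -mulrA ler_pM2l.
have [l3|l3] := leqP (len a b) 2.
  have -> : len a b = 2%N by apply/eqP; rewrite eqn_leq l3.
  have : 0 <= th * S by rewrite mulr_ge0.
  by rewrite mulrC; lra.
have hS : wt g a b * g ^+ (3 * len a b) <= S.
  have x0 : 0 <= wt g a b * g ^+ (3 * len a b) by rewrite mulr_ge0 ?(ltW w0) // exprn_ge0 // ltW.
  have one c d : flippable s a d c b -> wt g a b * g ^+ (3 * len a b) <= S.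
    move=> f; rewrite /S (bigD1 c) //= (bigD1 d) //= f mul1r -addrA lerDl addr_ge0 //.
      by apply: sumr_ge0 => ? _; rewrite mulr_ge0.
    by do 2 apply: sumr_ge0 => ? _; rewrite mulr_ge0.
  by have [/one|/one] := tri_flippable ts t1 t2 mm' l3.
have h1 : th * (wt g a b * g ^+ (3 * len a b)) <= th * S by rewrite ler_wpM2l.
have h2 : 0 <= th * g ^+ 6 * wt g a b by rewrite mulr_ge0 // ltW.
by rewrite mulrDr mulrCA mulrDl [wt g a b * B]mulrC; lra.
Qed.

Lemma same_midpoint s a b c d : good_family R s -> edge s a b -> edge s c d ->
  px a + px b = px c + px d -> py a + py b = py c + py d -> cseg a b = cseg c d.
Proof.
move=> gs eab ecd hx hy; apply/eqP/negP => /negP/eqP ne.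
rewrite (edge_cseg _ _ gs) in eab; rewrite (edge_cseg _ _ gs) in ecd.
pose x : R * R := (((px a + px b)%:~R / 2), ((py a + py b)%:~R / 2)).
have half01 : 0 < (2^-1 : R) < 1 by lra.
have midp (u v : pt n) : in_seg (ptR R u) (ptR R v) (((px u + px v)%:~R / 2), ((py u + py v)%:~R / 2)).
  exists 2^-1; split=> //; rewrite /= -/(px u) -/(px v) -/(py u) -/(py v) !intrD.
  by congr (_, _); lra.
have cs (u v : pt n) : in_openseg (cseg u v) (((px u + px v)%:~R / 2 : R), ((py u + py v)%:~R / 2 : R)).
  by case: (cseg_cases u v) => ->; [exact: (midp u v) | exact/in_seg_sym/(midp u v)].
apply: (proj2 gs _ _ eab ecd ne x); split; first exact: cs.
by rewrite /x hx hy; exact: cs.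
Qed.

(** By [same_midpoint], an oriented edge is recovered from its doubled midpoint and one orientation
    bit; this leaves two copies of a product of two geometric sums. *)
Lemma edge_sum_le s : good_family R s -> edge_sum s <= 2 * (2 / (1 - g^-1)) ^+ 2.
Proof.
(* A doubled midpoint is indexed by the sum of two coordinate indices, and [c] is the index of 0. *)
move=> gs; pose K := (2 * side n)%N; pose c := (2 * n./2)%N.
have iK (i j : 'I_(side n)) : (i + j < K)%N by have := ltn_ord i; have := ltn_ord j; rewrite /K; clear; lia.
pose h (ab : pt n * pt n) : ('I_K * 'I_K) * bool :=
  ((Ordinal (iK ab.1.1 ab.2.1), Ordinal (iK ab.1.2 ab.2.2)), canon ab).
pose D i : nat := ((i - c) + (c - i))%N.
pose G (x : ('I_K * 'I_K) * bool) : R := g^-1 ^+ D x.1.1 * g^-1 ^+ D x.1.2.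
have gV0 : 0 < g^-1 by rewrite invr_gt0.
have gV1 : g^-1 < 1 by rewrite invf_lt1.
have hG a b : wt g a b = G (h (a, b)).
  rewrite /wt /G -exprD -exprVn; congr (_ ^+ _).
  by rewrite /mid /px /py /crd /D /c /=; clear; lia.
rewrite /edge_sum pair_bigA /=.
apply: le_trans (_ : \sum_(x : pt n * pt n | edge s x.1 x.2) wt g x.1 x.2 <= _).
  rewrite [X in _ <= X]big_mkcond; apply: ler_sum => -[a b] _ /=.
  by case: ifP => _; rewrite ?mul1r ?mul0r.
apply: le_trans (_ : \sum_(x : ('I_K * 'I_K) * bool | true) G x <= _).
  apply: (@sum_le_of_inj _ _ _ (fun x => edge s x.1 x.2) _ h).
  - move=> [a b] [a' b'] /= e e' [h1 h2 h3].
    have hx : px a + px b = px a' + px b'.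
      have : ((a.1 : nat) + b.1 = a'.1 + b'.1)%N := h1.
      by rewrite /px /crd; clear; lia.
    have hy : py a + py b = py a' + py b'.
      have : ((a.2 : nat) + b.2 = a'.2 + b'.2)%N := h2.
      by rewrite /py /crd; clear; lia.
    have := same_midpoint gs (e : edge s a b) (e' : edge s a' b') hx hy.
    by rewrite /cseg -h3; case: ifP => _ [-> ->].
  - by move=> [a b] _ /=; rewrite -hG.
  - by move=> x _; rewrite mulr_ge0 // exprn_ge0 // ltW.
have hs : \sum_(i < K) g^-1 ^+ D i <= 2 / (1 - g^-1) by apply: geometric_two_sided; rewrite gV0.
have s0 : 0 <= \sum_(i < K) g^-1 ^+ D i by apply: sumr_ge0 => i _; rewrite exprn_ge0 // ltW.
have hG2 (e : bool) : \sum_(ij : 'I_K * 'I_K) G (ij, e) <= (2 / (1 - g^-1)) ^+ 2.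
  rewrite -(pair_bigA _ (fun i j : 'I_K => G ((i, j), e))) /G /=.
  under eq_bigr do rewrite -mulr_sumr.
  by rewrite -mulr_suml expr2; exact: ler_pM.
rewrite -(pair_bigA _ (fun (ij : 'I_K * 'I_K) (e : bool) => G (ij, e))) /= exchange_big big_bool.
by rewrite mulr_natl mulr2n lerD.
Qed.

(** The flip is injective, being undone by exchanging the diagonals again, and it multiplies the
    weight by lam^(-2|v|): reindexing along it gives the comparison. *)
Lemma flip_sum (x : quad) :
  \sum_(s in Omega R n) lam ^+ tlen s * (flippable_at s x)%:R <=
  \sum_(s in Omega R n) lam ^+ tlen s * (lam ^+ flip_gain x * (up_at s x)%:R).
Proof.
have big_if (P : {set seg n} -> bool) (F : {set seg n} -> R) :
    \sum_(s in Omega R n | P s) F s = \sum_(s in Omega R n) F s * (P s)%:R.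
  rewrite big_mkcondr; apply: eq_bigr => s _.
  by case: (P s); rewrite ?mulr1 ?mulr0.
rewrite -big_if; under [leRHS]eq_bigr do rewrite mulrA.
rewrite -big_if.
apply: (@sum_le_of_inj _ _ _ _ _ (fun s => flip s x.2.1 x.1.2 x.1.1 x.2.2)).
- move=> s s' /andP[/OmegaP ts fs] /andP[/OmegaP ts' fs'] e.
  by rewrite -(flipK (proj1 ts) fs) e (flipK (proj1 ts') fs').
- move=> s /andP[/OmegaP ts fs]; split.
    apply/andP; split; first exact/OmegaP/flip_triangulation.
    exact: (flip_up ts fs).
  by rewrite (flip_tlen (proj1 ts) fs) exprD.
- by move=> s _; rewrite mulr_ge0 // exprn_ge0 // ltW.
Qed.

Lemma flippable_sum_le_up_sum : \sum_(s in Omega R n) lam ^+ tlen s * flippable_sum s <=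
  \sum_(s in Omega R n) lam ^+ tlen s * up_sum s.
Proof.
have ex (F : {set seg n} -> quad -> R) :
    \sum_(s in Omega R n) lam ^+ tlen s * \sum_x F s x =
    \sum_x \sum_(s in Omega R n) lam ^+ tlen s * F s x.
  by rewrite exchange_big; apply: eq_bigr => s _; rewrite mulr_sumr.
rewrite !ex; apply: ler_sum => x _.
under eq_bigr do rewrite mulrA; rewrite -mulr_suml.
apply: le_trans (ler_wpM2r (ltW (charge_gt0 x)) (flip_sum x)) _.
by rewrite mulr_suml; apply: ler_sum => s _; rewrite le_eqVlt; apply/orP; left; apply/eqP; ring.
Qed.

(** An endpoint coordinate beyond (k + M)/2 with a midpoint coordinate within k/2 forces length more
    than [M]. Above this edge, [mid p q] is at most 2k plus the gain in length, so a single charge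
    is already at least g^(M - 2k). *)
Lemma flippable_sum_of_long_edge s k M : triangulation R s -> (1 < M)%N -> ~~ confined k (k + M) s ->
  g ^+ M / g ^+ (2 * k) <= flippable_sum s.
Proof.
move=> ts M2; rewrite /confined negb_forall => /existsP[[a b]].
rewrite !negb_imply => /andP[es /andP[mb]]; rewrite /mid_in_box /pt_in_box /= in mb * => nb.
have eab : edge s a b by rewrite /edge es.
rewrite -/(px a) -/(px b) -/(py a) -/(py b) in mb nb.
have lM : (M < len a b)%N.
  rewrite /len; case/andP: mb => mb1 mb2; rewrite !negb_and -!ltNge in nb.
  by move: (px a) (px b) (py a) (py b) mb1 mb2 nb => x1 x2 y1 y2; clear; lia.
have mk : (mid a b <= 2 * k)%N by case/andP: mb; rewrite /mid; clear; lia.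
have [p [m [m' [q [t1 t2 mm' h]]]]] := edge_below_flippable ts eab (ltn_trans M2 lM).
have [x [f xp xq]] : exists x, [/\ flippable_at s x, x.2.1 = p & x.2.2 = q].
  have [f|f] := tri_flippable ts t1 t2 mm' (leq_trans (leq_ltn_trans M2 lM) (leq_trans (leq_addr _ _) h)).
    by exists ((m', m), (p, q)).
  by exists ((m, m'), (p, q)).
apply: le_trans (_ : charge x <= _); last first.
  rewrite /flippable_sum (bigD1 x) //= f mul1r lerDl; apply: sumr_ge0 => y _.
  by rewrite mulr_ge0 // ltW // charge_gt0.
have mpq : (mid p q <= mid a b + offset a b p q)%N by rewrite /mid /offset; clear; lia.
rewrite /charge /wt xp xq ler_pdivrMr ?exprn_gt0 // -mulrA mulrC.
rewrite ler_pdivlMr ?exprn_gt0 // -!exprD ler_eXn2l //.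
by move: mk h lM mpq; clear; lia.
Qed.

End Weights.

(** * Tightness by Markov's inequality *)

Theorem mainTheorem14 (R : archiRealFieldType) (lam : R) (k : nat) :
  0 < lam < 1 -> (0 < k)%N ->
  forall delta : R, 0 < delta ->
  exists L : nat, forall n : nat, (k <= n)%N ->
    1 - delta <= prob lam (confined k L (n:=n)).
Proof.
move=> lam01 _ delta delta0; have [lam0 lam1] := andP lam01.
have [g g1 hg] := ratio_exists lam01.
have g0 : 0 < g by apply: lt_trans g1.
have eta01 : 0 < lam ^+ 2 * g ^+ 4 < 1 by rewrite hg andbT mulr_gt0 ?exprn_gt0.
have g21 : 1 < g ^+ 2 by rewrite exprn_egt1.
have [th [A [/andP[th0 th1] A0 hf]]] := discharging_constants g21 eta01.
(* Half of the slack 1 - th absorbs the linear part of the potential, which turns [th] into th' = (1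
   + th)/2. *)
have d0 : 0 < (1 - th) / 2 by lra.
have [B B0 hB] := linear_expr_bound g1 A0 d0.
pose th' := (1 + th) / 2.
have th'0 : 0 <= th' by rewrite /th'; lra.
have potB l : g ^+ l * pot g th A l <= th' * g ^+ (3 * l) + B.
  have -> : g ^+ l * pot g th A l = th * g ^+ (3 * l) + A * (l%:R - 1) * g ^+ l.
    by rewrite /pot -exprM (_ : (3 * l = l + 2 * l)%N) // exprD; ring.
  by have := hB l; rewrite /th'; lra.
pose E := (th' * g ^+ 6 + B) * (2 * (2 / (1 - g^-1)) ^+ 2).
(* This is E / (1 - th'), the bound on the expectation that follows from X <= th' X + E Z. *)
pose C := E * 2 / (1 - th).
have [M0 hM0] := expr_unbounded (C * g ^+ (2 * k) / delta) g1.
(* The added 2 makes the long edge longer than 2, so that the edge found above it is not the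
   diagonal of a unit square. *)
pose M := (M0 + 2)%N.
exists (k + M)%N => n _.
have drift (s : {set seg n}) : triangulation R s ->
    up_sum g lam s <= th' * flippable_sum g s + E.
  move=> ts; rewrite up_sumE.
  apply: le_trans (up_cost_le g1 lam0 th0 A0 _ _ _ ts) _.
  - by move=> u v u0 v0; have [] := hf u v u0 v0.
  - by move=> u v u0 v0; have [] := hf u v u0 v0.
  - by move=> u v u0 v0; have [] := hf u v u0 v0.
  apply: (@le_trans _ _ (th' * flippable_sum g s + (th' * g ^+ 6 + B) * edge_sum g s)); last first.
    have h0 : 0 <= th' * g ^+ 6 + B by rewrite addr_ge0 // mulr_ge0 // exprn_ge0 // ltW.
    by rewrite lerD2l (ler_wpM2l h0) // (edge_sum_le g1 (proj1 ts)).
  rewrite flippable_sumE /edge_sum !mulr_sumr -big_split; apply: ler_sum => a _ /=.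
  rewrite !mulr_sumr -big_split; apply: ler_sum => b _ /=.
  exact: bidown_charge.
pose Z := \sum_(s in Omega R n) weight lam s.
have wpos (s : {set seg n}) : 0 < weight lam s by rewrite exprn_gt0.
have Z0 : 0 < Z.
  have [s sO] := Omega_nonempty R n; rewrite /Z (bigD1 s) //=.
  by rewrite ltr_pwDl // sumr_ge0 // => t _; rewrite ltW.
pose X := \sum_(s in Omega R n) weight lam s * flippable_sum g s.
have XC : X <= C * Z.
  have h1 : X <= th' * X + E * Z.
    apply: le_trans (flippable_sum_le_up_sum _ g1 lam0) _.
    rewrite /X /Z !mulr_sumr -big_split; apply: ler_sum => s /OmegaP/drift hs /=.
    apply: le_trans (ler_wpM2l (ltW (wpos s)) hs) _.
    by rewrite mulrDr mulrCA [E * _]mulrC.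
  have : X * (1 - th) <= E * Z * 2 by move: h1; rewrite /th'; lra.
  rewrite -ler_pdivlMr; last by lra.
  by rewrite /C; congr (_ <= _); ring.
pose N := \sum_(s in Omega R n | ~~ confined k (k + M) s) weight lam s.
have NX : N * (g ^+ M / g ^+ (2 * k)) <= X.
  rewrite /N /X mulr_suml [X in _ <= X](bigID (fun s => confined k (k + M) s)) /= addrC ler_wpDr //.
    apply: sumr_ge0 => s _; rewrite mulr_ge0 ?(ltW (wpos s)) //.
    by apply: sumr_ge0 => x _; rewrite mulr_ge0 // (ltW (charge_gt0 g1 x)).
  apply: ler_sum => s /andP[/OmegaP ts nc]; rewrite ler_pM2l //.
  by apply: flippable_sum_of_long_edge => //; rewrite /M addn2.
have ND : N <= delta * Z.
  have hM : C * g ^+ (2 * k) <= delta * g ^+ M.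
    have := hM0 M (leq_addr _ _); rewrite ler_pdivrMr //; lra.
  have gk : 0 < g ^+ (2 * k) by rewrite exprn_gt0.
  have gM : 0 < g ^+ M by rewrite exprn_gt0.
  have h1 : N * g ^+ M <= C * Z * g ^+ (2 * k).
    by rewrite -ler_pdivrMr // -mulrA; apply: le_trans NX XC.
  have h2 : C * Z * g ^+ (2 * k) <= delta * Z * g ^+ M.
    by rewrite -mulrA [Z * _]mulrC mulrA -[leRHS]mulrA [Z * g ^+ M]mulrC mulrA ler_pM2r.
  by have := le_trans h1 h2; rewrite ler_pM2r.
rewrite /prob -/Z ler_pdivlMr // mulrBl mul1r.
have : Z = \sum_(s in Omega R n | confined k (k + M) s) weight lam s + N by rewrite /Z (bigID (@confined k (k + M) n)).
by move=> e; lra.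
Qed.
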